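(* Let $H=T+V$ be as in the context, let $w>0$, $E_0\in\mathbb{R}$, $W=[E_0-N^{-(1-w)},E_0+N^{-(1-w)}]$, let $\eta=N^{-(1+\ell)}$ with $\ell>w$, and let $Y\subset\{1,\dots,N\}$. Then there exists $C<\infty$, depending only on $C_V$, such that \[\mathbb{P}\Big(\sum_{y\in Y}Q(x,y;W)>\frac{2}{\pi}\sum_{y\in Y}\int_W|\operatorname{Im}G(x,y;E+i\eta)|\,dE+\frac{\log N}{N^w}\Big)\le CN^{w-\ell}\] for all $x\in\{1,\dots,N\}$.
   Context: $H=T+V$ is an $N\times N$ real symmetric random matrix, where $V=\sum_x V(x)|\delta_x\rangle\langle\delta_x|$ is a random diagonal potential with $\mathbb{P}(V(x)\in I\mid\{V(y)\}_{y\ne x})\le C_V|I|$ for all Borel $I\subset\mathbb{R}$ and all $x$, and $T$ is a real symmetric random matrix independent of $V$. $G(x,y;z)=\langle\delta_y,(H-z)^{-1}\delta_x\rangle$. With $\{\psi_\lambda\}$ an orthonormal basis of real eigenfunctions of $H$, $Q(x,y;W)=\sum_{\lambda\in\sigma(H)\cap W}|\psi_\lambda(x)\psi_\lambda(y)|$. *)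

(* Defs.v *)
From HB Require Import structures.
From mathcomp Require Import all_boot all_order all_algebra.
From mathcomp Require Import all_classical all_reals all_analysis.
From mathcomp Require Import complex.
Set Implicit Arguments. Unset Strict Implicit. Unset Printing Implicit Defensive.
Import Order.TTheory GRing.Theory Num.Theory.
Local Open Scope classical_set_scope.
Local Open Scope ring_scope.

Section Defs.
Variable R : realType.

Definition Hmat (n : nat) (T : 'M[R]_n) (V : 'I_n -> R) : 'M[R]_n :=
  T + diag_mx (\row_x V x).

(* Green function G(x,y;z) = < delta_y, (H - z)^{-1} delta_x > = ((H-z)^{-1})_{y x} *)
Definition green (n : nat) (H : 'M[R]_n) (x y : 'I_n) (z : complex.complex R)
  : complex.complex R :=
  (invmx (map_mx (fun r : R => complex.Complex r 0) H - z%:M)) y x.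

(* Q(x,y;W) = sum over eigenpairs (columns k of the orthogonal matrix Psi,
   eigenvalue lam k) with lam k in [a,b] of |psi_k(x) psi_k(y)| *)
Definition Qsum (n : nat) (Psi : 'M[R]_n) (lam : 'I_n -> R) (a b : R)
  (x y : 'I_n) : R :=
  \sum_(k < n | a <= lam k <= b) `|Psi x k * Psi y k|.

Definition is_eigbasis (n : nat) (H Psi : 'M[R]_n) (lam : 'I_n -> R) : Prop :=
  Psi^T *m Psi = 1%:M /\ H *m Psi = Psi *m diag_mx (\row_k lam k).

Context d (Omega : measurableType d).

Definition sigma_gen (I : Type) (f : I -> Omega -> R) : set (set Omega) :=
  <<s [set A | exists i (J : set R), measurable J /\ A = f i @^-1` J] >>.

End Defs.

(* Main.v *)
Require Import Defs.
From HB Require Import structures.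
From mathcomp Require Import all_boot all_order all_algebra.
From mathcomp Require Import all_classical all_reals all_analysis.
From mathcomp Require Import complex.
From mathcomp Require Import measurable_realfun.
From mathcomp Require Import ring lra.
Set Implicit Arguments. Unset Strict Implicit. Unset Printing Implicit Defensive.
Import Order.TTheory GRing.Theory Num.Theory.
Import numFieldNormedType.Exports.
Local Open Scope classical_set_scope.
Local Open Scope ring_scope.

(* Smoothing at scale [eta] loses nothing essential when the eigenvalues in [W]
   are separated by a large multiple of [eta] and stay away from the edges of
   [W]: the windows of radius [4 eta] around them are disjoint, each carries all
   but a fraction [1/(2 pi)] of the mass [pi] of its own Poisson kernel, and the
   other kernels contribute little there. Hence [int_W |Im G| >= (pi - 1) Q]
   up to the leakage of the eigenvalues outside [W], and [(2/pi)(pi-1) >= 1].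

   The exceptional events have probability [O(N^(w-l))]. A pair of eigenvalues
   in a window of size [O(eta)] is excluded by a Minami estimate, an eigenvalue
   within [4 N^w eta] of an edge by a Wegner estimate. For the leakage, weights
   [sum_y |psi(x) psi(y)|] are bounded by [(N psi(x)^2 + 1) / 2]; eigenvalues at
   distance more than [N^(1+w) eta / ln N] contribute at most half of
   [ln N / N^w] deterministically, and the [O(ln N)] dyadic scales in between
   are controlled in expectation by Wegner and Markov.

   Everything is phrased with the real matrix [((H - E)^2 + r^2)^-1]. Its [x]-th
   diagonal entry is a Lorentzian in [V x] of width at least [r], whose two
   parameters depend on the other variables only; averaging over [V x] gives the
   Wegner estimate with weights. For Minami, two eigenvectors near [E] have a
   combination vanishing at [x], so that the matrix with row and column [x]
   removed still has an eigenvalue near [E], and it does not depend on [V x]. *)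

(** * Resolvents of real symmetric matrices *)

Section LinearAlgebra.
Variables (R : realType) (n : nat).
Implicit Types (H A B : 'M[R]_n) (u v : 'cV[R]_n) (E r : R) (x y : 'I_n).

Definition dot u v : R := (u^T *m v) 0 0.

Lemma dotE u v : dot u v = \sum_i u i 0 * v i 0.
Proof. by rewrite /dot mxE; apply: eq_bigr => i _; rewrite !mxE. Qed.

Lemma dotC u v : dot u v = dot v u.
Proof. by rewrite !dotE; apply: eq_bigr => i _; rewrite mulrC. Qed.

Lemma dotDr u v w : dot u (v + w) = dot u v + dot u w.
Proof. by rewrite /dot mulmxDr mxE. Qed.

Lemma dotZr u a v : dot u (a *: v) = a * dot u v.
Proof. by rewrite /dot -scalemxAr mxE. Qed.

Lemma dotZl a u v : dot (a *: u) v = a * dot u v.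
Proof. by rewrite dotC dotZr dotC. Qed.

Lemma dotBr u v w : dot u (v - w) = dot u v - dot u w.
Proof. by rewrite dotDr -scaleN1r dotZr mulN1r. Qed.

Lemma dotBl u v w : dot (u - v) w = dot u w - dot v w.
Proof. by rewrite dotC dotBr !(dotC w). Qed.

Lemma dot_mull A u v : dot (A *m u) v = dot u (A^T *m v).
Proof. by rewrite /dot trmx_mul mulmxA. Qed.

Lemma dot_ge0 u : 0 <= dot u u.
Proof. by rewrite dotE sumr_ge0 // => i _; rewrite -expr2 sqr_ge0. Qed.

Lemma dot_eq0 u : dot u u = 0 -> u = 0.
Proof.
rewrite dotE => /eqP; rewrite psumr_eq0 => [/allP u0|i _]; last first.
  by rewrite -expr2 sqr_ge0.
apply/colP => i; rewrite mxE; apply/eqP; rewrite -sqrf_eq0 expr2.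
by apply: u0; rewrite mem_index_enum.
Qed.

Lemma dot_ge_coord u x : u x 0 ^+ 2 <= dot u u.
Proof.
rewrite dotE (bigD1 x) //= -expr2 lerDl sumr_ge0 // => i _.
by rewrite -expr2 sqr_ge0.
Qed.

Definition evec x : 'cV[R]_n := delta_mx x 0.

Lemma dot_evec u x : dot u (evec x) = u x 0.
Proof.
rewrite dotE (bigD1 x) //= mxE !eqxx mulr1 big1 ?addr0 // => i /negPf ix.
by rewrite mxE ix mulr0.
Qed.

Lemma mul_evec A x y : (A *m evec x) y 0 = A y x.
Proof. by rewrite /evec -colE mxE. Qed.

(** The product [(H - E - i r)(H - E + i r)] written without complex numbers. It is positive
    definite for [r > 0], and [r *: resK] is then the imaginary part of the resolvent at
    [E + i r]. *)
Definition resA H E r : 'M[R]_n :=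
  (H - E%:M) *m (H - E%:M) + (r ^+ 2)%:M.

Definition resK H E r : 'M[R]_n := invmx (resA H E r).

(* [2 r Im G(x,x; E + i r)]; it bounds the [x]-weight of the eigenvalues in
   [[E - r, E + r]]. *)
Definition lor H E r x : R := 2 * r ^+ 2 * resK H E r x x.

Lemma sym_shift H E : H^T = H -> (H - E%:M)^T = H - E%:M.
Proof. by move=> sH; rewrite linearB /= sH tr_scalar_mx. Qed.

Lemma resA_sym H E r : H^T = H -> (resA H E r)^T = resA H E r.
Proof.
by move=> sH; rewrite /resA linearD /= trmx_mul sym_shift // tr_scalar_mx.
Qed.

Lemma dot_resA H E r u v : H^T = H ->
  dot u (resA H E r *m v)
  = dot ((H - E%:M) *m u) ((H - E%:M) *m v) + r ^+ 2 * dot u v.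
Proof.
move=> sH; rewrite /resA mulmxDl dotDr -mulmxA dot_mull sym_shift //.
by rewrite mul_scalar_mx dotZr.
Qed.

Lemma resA_unit H E r : H^T = H -> 0 < r -> resA H E r \in unitmx.
Proof.
move=> sH r0; rewrite -unitmx_tr -row_free_unit -kermx_eq0.
apply/rowV0P => w /sub_kermxP w0.
have Aw : resA H E r *m w^T = 0.
  by apply: trmx_inj; rewrite trmx_mul trmxK w0 trmx0.
have := @dot_resA H E r w^T w^T sH; rewrite Aw.
rewrite (_ : dot w^T 0 = 0); last by rewrite /dot mulmx0 mxE.
have := dot_ge0 ((H - E%:M) *m w^T); have := dot_ge0 w^T => d1 d2 e.
have /dot_eq0 : dot w^T w^T = 0.
  by apply/eqP; rewrite eq_le d1 andbT -(pmulr_rle0 _ (exprn_gt0 2 r0)); lra.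
by move=> /(congr1 trmx); rewrite trmxK trmx0.
Qed.

Lemma mul_resA_K H E r : H^T = H -> 0 < r -> resA H E r *m resK H E r = 1%:M.
Proof. by move=> sH r0; rewrite mulmxV // resA_unit. Qed.

Lemma resK_sym H E r : H^T = H -> (resK H E r)^T = resK H E r.
Proof. by move=> sH; rewrite /resK trmx_inv resA_sym. Qed.

(* Legendre duality: [K_yy = max_u (2 u_y - <u, A u>)]. *)
Lemma resK_variational H E r u y : H^T = H -> 0 < r ->
  2 * u y 0 - dot u (resA H E r *m u) <= resK H E r y y.
Proof.
move=> sH r0; set A := resA H E r.
pose w := resK H E r *m evec y.
have Aw : A *m w = evec y by rewrite mulmxA mul_resA_K // mul1mx.
have : 0 <= dot (w - u) (A *m (w - u)).
  by rewrite dot_resA // addr_ge0 ?dot_ge0 // mulr_ge0 ?dot_ge0 // sqr_ge0.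
rewrite mulmxBr dotBl !dotBr Aw !dot_evec mul_evec.
have -> : dot w (A *m u) = u y 0.
  by rewrite dotC dot_mull /A resA_sym // Aw dot_evec.
lra.
Qed.

Lemma lor_ge0 H E r x : H^T = H -> 0 < r -> 0 <= lor H E r x.
Proof.
move=> sH r0; rewrite /lor mulr_ge0 //.
  by rewrite mulr_ge0 // sqr_ge0.
have := @resK_variational H E r 0 x sH r0.
by rewrite mulmx0 dotE big1 ?mxE => [|i _]; rewrite ?mxE ?mulr0 ?subr0.
Qed.

Lemma eigbasis_sqnorm H Psi lam (w : 'cV[R]_n) : is_eigbasis H Psi lam ->
  dot (Psi *m w) (Psi *m w) = \sum_k w k 0 ^+ 2.
Proof.
by move=> [PP _]; rewrite dot_mull mulmxA PP mul1mx dotE.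
Qed.

Lemma eigbasis_shift H Psi lam E (w : 'cV[R]_n) : is_eigbasis H Psi lam ->
  (H - E%:M) *m (Psi *m w) = Psi *m \col_k ((lam k - E) * w k 0).
Proof.
move=> [PP HP]; rewrite mulmxBl mulmxA HP mul_scalar_mx -mulmxA scalemxAr.
rewrite -mulmxBr; congr (_ *m _); apply/colP => k.
by rewrite mul_diag_mx !mxE mulrBl.
Qed.

Lemma eigbasis_resA H Psi lam E r (w : 'cV[R]_n) :
  H^T = H -> is_eigbasis H Psi lam ->
  dot (Psi *m w) (resA H E r *m (Psi *m w))
  = \sum_k ((lam k - E) ^+ 2 + r ^+ 2) * w k 0 ^+ 2.
Proof.
move=> sH eb; rewrite dot_resA // (eigbasis_shift _ _ eb).
rewrite !(eigbasis_sqnorm _ eb) big_distrr /= -big_split /=.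
by apply: eq_bigr => k _; rewrite mxE; ring.
Qed.

(** Test [resK_variational] with the spectral projection of [evec x] onto [[E - r, E + r]], scaled
    by [c]. On that subspace [resA] is at most [2 r^2], so the quadratic term costs at most half of
    the linear one. *)
Lemma eig_weight_le_lor H Psi lam E r x :
  H^T = H -> 0 < r -> is_eigbasis H Psi lam ->
  \sum_(k | `|lam k - E| <= r) Psi x k ^+ 2 <= lor H E r x.
Proof.
move=> sH r0 eb; set S := \sum_(k | _) _.
have S0 : 0 <= S by apply: sumr_ge0 => k _; rewrite sqr_ge0.
pose c := (2 * r ^+ 2)^-1.
have c0 : 0 < c by rewrite invr_gt0 mulr_gt0 // exprn_gt0.
pose w : 'cV[R]_n := \col_k (if `|lam k - E| <= r then c * Psi x k else 0).
have := @resK_variational H E r (Psi *m w) x sH r0.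
rewrite (eigbasis_resA _ _ _ sH eb).
have -> : (Psi *m w) x 0 = c * S.
  rewrite mxE /S big_distrr /= [RHS]big_mkcond /=; apply: eq_bigr => k _.
  by rewrite mxE; case: ifP => _; ring.
have : \sum_k ((lam k - E) ^+ 2 + r ^+ 2) * w k 0 ^+ 2 <= c * S.
  rewrite /S big_distrr /= [leRHS]big_mkcond /=; apply: ler_sum => k _.
  rewrite mxE; case: ifP => [kr|_]; last by rewrite expr0n /= mulr0.
  have k2 : (lam k - E) ^+ 2 <= r ^+ 2.
    by rewrite -real_normK ?num_real // ler_sqr ?nnegrE // ltW.
  rewrite exprMn mulrA ler_wpM2r ?sqr_ge0 // expr2 mulrA ler_piMl //.
    exact: ltW.
  have {1}-> : 1 = (2 * r ^+ 2) * c by rewrite divff // mulf_neq0 // expf_neq0 // gt_eqF.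
  by rewrite ler_wpM2r ?(ltW c0) //; lra.
move=> h1 h2; rewrite /lor.
have -> : S = (2 * r ^+ 2) * (c * S).
  by rewrite mulrA divff ?mul1r // mulf_neq0 // expf_neq0 // gt_eqF.
by rewrite ler_wpM2l ?mulr_ge0 ?sqr_ge0 //; lra.
Qed.

(** Row and column [x] are set to zero instead of deleted, which keeps the matrix type. The price is
    a spurious eigenvector [evec x] of eigenvalue 0; test vectors vanishing at [x] and sums over
    [y != x] avoid it. *)
Definition strip H x : 'M[R]_n :=
  \matrix_(i, j) (if (i == x) || (j == x) then 0 else H i j).

Lemma strip_sym H x : H^T = H -> (strip H x)^T = strip H x.
Proof.
move=> sH; apply/matrixP => i j; rewrite !mxE orbC.
by case: ifP => // _; rewrite -[in LHS]sH mxE.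
Qed.

(** Off [x] the two matrices act alike on [u]; at [x] the left-hand vector is zero, so it is a
    truncation of the right-hand one. *)
Lemma strip_shift_le H E x u : u x 0 = 0 ->
  dot ((strip H x - E%:M) *m u) ((strip H x - E%:M) *m u)
  <= dot ((H - E%:M) *m u) ((H - E%:M) *m u).
Proof.
move=> ux; rewrite !dotE; apply: ler_sum => i _; rewrite -!expr2.
case: (eqVneq i x) => [->|ix].
  rewrite mxE big1 ?expr0n ?sqr_ge0 // => j _.
  rewrite !mxE eqxx /=; case: eqVneq => [<-|]; first by rewrite ux mulr0.
  by rewrite mulr0n subr0 mul0r.
rewrite [X in X ^+ 2](_ : _ = ((H - E%:M) *m u) i 0) // !mxE.
apply: eq_bigr => j _; rewrite !mxE (negPf ix) /=.
by case: (eqVneq j x) => [->|//]; rewrite ux !mulr0.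
Qed.

(* A combination of the two eigenvectors vanishes at [x]; it is an approximate
   eigenvector of the stripped matrix supported off [x]. *)
Lemma two_eig_strip H Psi lam E r x k k' :
  H^T = H -> 0 < r -> is_eigbasis H Psi lam ->
  k != k' -> `|lam k - E| <= r -> `|lam k' - E| <= r ->
  1 <= \sum_(y | y != x) lor (strip H x) E r y.
Proof.
move=> sH r0 eb kk' kr kr'.
have [w [wx w0 wJ]] : exists w : 'cV[R]_n, [/\ (Psi *m w) x 0 = 0,
    0 < \sum_j w j 0 ^+ 2 & forall j, j != k -> j != k' -> w j 0 = 0].
  (* The combination [- psi_k'(x) psi_k + psi_k(x) psi_k'] vanishes at [x]. If [psi_k(x) = 0] it
     might be the zero vector, and [psi_k] itself is taken. *)
  pose al := if Psi x k == 0 then 1 else - Psi x k'.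
  pose be := Psi x k.
  pose w : 'cV[R]_n := \col_j (if j == k then al else if j == k' then be else 0).
  have wE (F : 'I_n -> R -> R) : (forall j, F j 0 = 0) ->
      \sum_j F j (w j 0) = F k al + F k' be.
    move=> F0; rewrite (bigD1 k) //= (bigD1 k') /=; last by rewrite eq_sym.
    rewrite !mxE eqxx eq_sym (negPf kk') eqxx big1 ?addr0 // => j /andP[jk jk'].
    by rewrite mxE (negPf jk) (negPf jk') F0.
  exists w; split.
  - rewrite mxE (wE (fun j z => Psi x j * z)) => [|j]; last by rewrite mulr0.
    rewrite /al /be; case: eqVneq => [->|_]; last by ring.
    by rewrite mul0r mulr0 addr0.
  - rewrite (wE (fun j z => z ^+ 2)) => [|j]; last by rewrite expr0n.
    rewrite /al /be; case: eqVneq => [->|b0].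
      by rewrite expr0n addr0 expr1n.
    by rewrite ltr_wpDl ?sqr_ge0 // exprn_even_gt0.
  - by move=> j jk jk'; rewrite mxE (negPf jk) (negPf jk').
set u := Psi *m w; set m := \sum_j _ in w0.
have um : dot u u = m by rewrite /u (eigbasis_sqnorm _ eb).
have r20 : 0 < 2 * r ^+ 2 by rewrite mulr_gt0 // exprn_gt0.
set A := resA (strip H x) E r.
have uAu : dot u (A *m u) <= 2 * r ^+ 2 * m.
  rewrite /A dot_resA ?strip_sym // um.
  apply: (@le_trans _ _ (r ^+ 2 * m + r ^+ 2 * m)); last by lra.
  rewrite lerD2r (le_trans (@strip_shift_le H E x u wx)) //.
  rewrite (eigbasis_shift _ _ eb) (eigbasis_sqnorm _ eb) /m big_distrr /=.
  apply: ler_sum => j _; rewrite mxE exprMn.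
  have jj l : `|lam l - E| <= r -> (lam l - E) ^+ 2 <= r ^+ 2.
    by move=> lr; rewrite -real_normK ?num_real // ler_sqr ?nnegrE // ltW.
  case: (eqVneq j k) => [->|jk]; first by rewrite ler_wpM2r ?sqr_ge0 ?jj.
  case: (eqVneq j k') => [->|jk']; first by rewrite ler_wpM2r ?sqr_ge0 ?jj.
  by rewrite wJ // expr0n /= !mulr0.
(* Since [dot u (A *m u)] is at most [1 / s], the test vector [(s u_y) u] gives [K_yy >= s u_y^2];
   summing over [y] yields [s m = 1 / (2 r^2)]. *)
pose s := (2 * r ^+ 2 * m)^-1.
have s0 : 0 < s by rewrite invr_gt0 mulr_gt0.
have sm : s * (2 * r ^+ 2 * m) = 1 by rewrite mulVf // gt_eqF // mulr_gt0.
have key y : s * u y 0 ^+ 2 <= resK (strip H x) E r y y.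
  apply: le_trans (@resK_variational _ E r ((s * u y 0) *: u) y (strip_sym _ sH) r0).
  rewrite -scalemxAr dotZl dotZr [X in 2 * X]mxE -/A.
  have : s * u y 0 * (s * u y 0 * dot u (A *m u)) <= s * u y 0 ^+ 2.
    have -> : s * u y 0 * (s * u y 0 * dot u (A *m u))
      = (s * u y 0 ^+ 2) * (s * dot u (A *m u)) by ring.
    apply: ler_piMr; first by rewrite mulr_ge0 ?sqr_ge0 ?(ltW s0).
    by rewrite -[leRHS]sm ler_wpM2l ?(ltW s0).
  by rewrite expr2; move: (u y 0) (dot _ _) => uy d h; lra.
rewrite /lor -big_distrr /=.
have : s * m <= \sum_(y | y != x) resK (strip H x) E r y y.
  rewrite -um dotE (bigD1 x) //= wx mulr0 add0r big_distrr /=.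
  by apply: ler_sum => y _; rewrite -expr2 key.
have e1 : 2 * r ^+ 2 * (s * m) = 1 by rewrite -[RHS]sm mulrCA.
by move=> h; rewrite -[leLHS]e1 ler_wpM2l // ltW.
Qed.

(* [polep + i poleq] is [G0(x,x; E + i r)] and [polem] its squared modulus;
   [polea + i poleb] is [-1/G0], the pole of [v |-> G(x,x; E + i r)]. *)
Definition poleq H0 E r x : R := r * resK H0 E r x x.
Definition polep H0 E r x : R := (resK H0 E r *m (H0 - E%:M)) x x.
Definition polem H0 E r x : R := polep H0 E r x ^+ 2 + poleq H0 E r x ^+ 2.
Definition polea H0 E r x : R := - polep H0 E r x / polem H0 E r x.
Definition poleb H0 E r x : R := poleq H0 E r x / polem H0 E r x.

(** With [w = K e_x], the entry [K_xx = |B w|^2 + r^2 |w|^2] dominates the squared [x]-coordinates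
    of [B w] and [r w], which are [polep] and [poleq]. The inequality is [r |G0|^2 <= Im G0]; it
    forces the Lorentzian in [V x] to have width at least [r]. *)
Lemma polem_gt0_le H0 E r x : H0^T = H0 -> 0 < r ->
  0 < polem H0 E r x /\ r * polem H0 E r x <= poleq H0 E r x.
Proof.
move=> sH r0; set K := resK H0 E r; set B := H0 - E%:M.
pose w := K *m evec x.
have Aw : resA H0 E r *m w = evec x by rewrite mulmxA mul_resA_K // mul1mx.
have wx : w x 0 = K x x by rewrite mul_evec.
have Bw : (B *m w) x 0 = polep H0 E r x.
  rewrite mulmxA mul_evec.
  have -> : B *m K = (K *m B)^T by rewrite trmx_mul resK_sym // sym_shift.
  by rewrite mxE.
have qE : K x x = dot (B *m w) (B *m w) + r ^+ 2 * dot w w.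
  by rewrite -dot_resA // Aw dot_evec.
have w0 : 0 < dot w w.
  rewrite lt_neqAle dot_ge0 andbT eq_sym; apply/eqP => /dot_eq0 w0.
  have /colP/(_ x) := Aw; rewrite w0 mulmx0 !mxE !eqxx => /eqP.
  by rewrite eq_sym oner_eq0.
have K0 : 0 < K x x.
  by rewrite qE ltr_wpDl ?dot_ge0 // mulr_gt0 // exprn_gt0.
have h1 := dot_ge_coord (B *m w) x; have h2 := dot_ge_coord w x.
rewrite Bw in h1; rewrite wx in h2.
rewrite /polem /poleq -/K; split.
  by rewrite ltr_wpDl ?sqr_ge0 // exprn_gt0 // mulr_gt0.
by rewrite ler_pM2l // [leRHS]qE exprMn lerD // ler_wpM2l // sqr_ge0.
Qed.

Lemma poleb_ge H0 E r x : H0^T = H0 -> 0 < r -> r <= poleb H0 E r x.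
Proof.
move=> sH r0; have [m0 h] := @polem_gt0_le H0 E r x sH r0.
by rewrite /poleb ler_pdivlMr.
Qed.

(* Real and imaginary parts of [G_xx = G0_xx / (1 + v G0_xx)]. *)
Lemma lor_rank1 H0 E r x (v : R) : H0^T = H0 -> 0 < r ->
  lor (H0 + v *: delta_mx x x) E r x
  = 2 * r * (poleb H0 E r x /
             ((v - polea H0 E r x) ^+ 2 + poleb H0 E r x ^+ 2)).
Proof.
move=> sH r0; set H := H0 + _.
have sD : (delta_mx x x : 'M[R]_n)^T = delta_mx x x by rewrite trmx_delta.
have sH' : H^T = H by rewrite /H linearD linearZ /= sH sD.
have [m0 _] := @polem_gt0_le H0 E r x sH r0.
set B := H - E%:M; set B0 := H0 - E%:M.
have BE : B = B0 + v *: delta_mx x x by rewrite /B /H addrAC.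
(* [p + i q] is the [x]-th column of the resolvent *)
pose q M := r *: (resK M E r *m evec x).
pose p M := resK M E r *m ((M - E%:M) *m evec x).
have eqs M : M^T = M -> (M - E%:M) *m p M + r *: q M = evec x /\
    (M - E%:M) *m q M = r *: p M.
  move=> sM.
  have comm : resA M E r *m (M - E%:M) = (M - E%:M) *m resA M E r.
    by rewrite /resA mulmxDl mulmxDr mulmxA mul_scalar_mx mul_mx_scalar.
  have commK : (M - E%:M) *m resK M E r = resK M E r *m (M - E%:M).
    have uA := resA_unit E sM r0.
    rewrite -[LHS]mul1mx -(mulVmx uA) -!mulmxA; congr (_ *m _).
    by rewrite (mulmxA (resA M E r)) comm -mulmxA mul_resA_K // mulmx1.
  rewrite /p /q; split.
    transitivity (resK M E r *m (resA M E r *m evec x)); last first.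
      by rewrite mulmxA mulVmx ?resA_unit // mul1mx.
    have -> : resA M E r *m evec x
      = (M - E%:M) *m ((M - E%:M) *m evec x) + r ^+ 2 *: evec x.
      by rewrite /resA mulmxDl mul_scalar_mx mulmxA.
    rewrite mulmxDr -scalemxAr scalerA -expr2; congr (_ + _).
    by rewrite (mulmxA (M - E%:M) (resK M E r)) commK -mulmxA.
  by rewrite -scalemxAr (mulmxA (M - E%:M) (resK M E r)) commK -mulmxA.
have [e1 e2] := eqs _ sH'; have [f1 f2] := eqs _ sH.
rewrite -/B in e1 e2; rewrite -/B0 in f1 f2.
(* Moving [B] across the pairing leaves [B0] and a rank-one correction. Applied to the four pairs of
   real and imaginary columns, it gives [G0 = G + v G0 G], with real part [r1] and imaginary part
   [r2]. *)
have dBp u w : dot u (B *m w) = dot (B0 *m u) w + v * u x 0 * w x 0.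
  rewrite BE mulmxDl dotDr dot_mull sym_shift // -/B0 -scalemxAl dotZr.
  congr (_ + _); rewrite -mulrA; congr (_ * _).
  rewrite dotE (bigD1 x) //= big1 ?addr0 => [|i ix].
    rewrite mxE (bigD1 x) //= mxE !eqxx mul1r big1 ?addr0 // => i ix.
    by rewrite mxE eqxx (negPf ix) mul0r.
  by rewrite mxE big1 ?mulr0 // => j _; rewrite mxE (negPf ix) mul0r.
have p0E : p H0 x 0 = polep H0 E r x by rewrite /p mulmxA mul_evec.
have q0E : q H0 x 0 = poleq H0 E r x by rewrite mxE mul_evec.
have LE : lor H E r x = 2 * r * q H x 0 by rewrite mxE mul_evec /lor; ring.
have g1 := dBp (p H0) (p H); have g2 := dBp (q H0) (q H).
have g3 := dBp (p H0) (q H); have g4 := dBp (q H0) (p H).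
have Bp : B *m p H = evec x - r *: q H by rewrite -e1 addrK.
have B0p : B0 *m p H0 = evec x - r *: q H0 by rewrite -f1 addrK.
rewrite !(Bp, B0p, e2, f2, dotBr, dotBl, dotZl, dotZr, dot_evec) in g1 g2 g3 g4.
rewrite !(dotC (evec x)) !dot_evec p0E q0E in g1 g2 g3 g4.
rewrite LE /poleb /polea; congr (_ * _).
have mE : polem H0 E r x = polep H0 E r x ^+ 2 + poleq H0 E r x ^+ 2 by [].
move: g1 g2 g3 g4 m0 mE.
set P := polep _ _ _ _; set Q := poleq _ _ _ _; set m := polem _ _ _ _.
set p1 := p H x 0; set q1 := q H x 0 => g1 g2 g3 g4 m0 mE.
have r1 : P = p1 + v * (P * p1 - Q * q1) by lra.
have qx : r * (resK H E r *m evec x) x 0 = q1 by rewrite /q1 /q [RHS]mxE.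
have r2 : Q = q1 + v * (P * q1 + Q * p1) by lra.
have Q0 : 0 < Q.
  have [_ h] := @polem_gt0_le H0 E r x sH r0.
  by apply: lt_le_trans h; rewrite mulr_gt0.
have mn0 : m != 0 by rewrite gt_eqF.
(* Eliminating [p1] from [r1] and [r2]: this is [Im G0 = Im G |1 + v G0|^2]. *)
have QD : Q = q1 * (m * v ^+ 2 + 2 * v * P + 1).
  apply/eqP; rewrite -subr_eq0 mE.
  have -> : Q - q1 * ((P ^+ 2 + Q ^+ 2) * v ^+ 2 + 2 * v * P + 1)
    = (1 + v * P) * (Q - (q1 + v * (P * q1 + Q * p1)))
      - v * Q * (P - (p1 + v * (P * p1 - Q * q1))) by ring.
  by rewrite -r1 -r2 !subrr !mulr0 subrr.
have D0 : m * v ^+ 2 + 2 * v * P + 1 != 0.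
  by apply/eqP => D0; move: Q0; rewrite QD D0 mulr0 ltxx.
have -> : (v - - P / m) ^+ 2 + (Q / m) ^+ 2 = (m * v ^+ 2 + 2 * v * P + 1) / m.
  have -> : (v - - P / m) ^+ 2 + (Q / m) ^+ 2
    = v ^+ 2 + 2 * v * P / m + (P ^+ 2 + Q ^+ 2) / m ^+ 2 by field.
  by rewrite -mE; field.
rewrite {1}QD; field.
by rewrite D0 mn0.
Qed.
End LinearAlgebra.

(** * Lorentzian integrals *)

Section Lorentz.
Variable R : realType.
Implicit Types a b c d u : R.
Local Notation mu := (@lebesgue_measure R).

Definition lorentz b a u : R := b / ((u - a) ^+ 2 + b ^+ 2).

Lemma lorentz_den_gt0 b a u : 0 < b -> 0 < (u - a) ^+ 2 + b ^+ 2.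
Proof. by move=> b0; rewrite ltr_wpDl ?sqr_ge0 // exprn_gt0. Qed.

Lemma lorentz_gt0 b a u : 0 < b -> 0 < lorentz b a u.
Proof. by move=> b0; rewrite divr_gt0 ?lorentz_den_gt0. Qed.

Lemma lorentz_ge0 b a u : 0 < b -> 0 <= lorentz b a u.
Proof. by move=> /lorentz_gt0 h; exact: ltW. Qed.

Lemma is_derive_atan_lorentz b a u : 0 < b ->
  is_derive u 1 (fun v => atan ((v - a) / b)) (lorentz b a u).
Proof.
move=> b0.
have h : is_derive u 1 (fun v => (v - a) / b) (b^-1).
  apply: is_derive_eq; rewrite !scaler0 add0r.
  by rewrite subr0 /GRing.scale /= mulr1.
have := @is_derive1_comp _ (@atan R) _ u _ _ (is_derive1_atan _) h.
rewrite /comp => /is_derive_eq; apply.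
have b1 : b != 0 by rewrite gt_eqF.
have d1 : (u - a) ^+ 2 + b ^+ 2 != 0 by rewrite gt_eqF // lorentz_den_gt0.
rewrite /lorentz; have -> : 1 + ((u - a) / b) ^+ 2 = ((u - a) ^+ 2 + b ^+ 2) / b ^+ 2.
  by field.
by field; rewrite d1 b1.
Qed.

Lemma continuous_lorentz b a : 0 < b -> continuous (lorentz b a).
Proof.
move=> b0 u; apply: cvgM; first exact: cvg_cst.
apply: cvgV; first by rewrite gt_eqF // lorentz_den_gt0.
apply: cvgD; last exact: cvg_cst.
have h : (fun v : R => v - a) @ u --> u - a.
  by apply: cvgB; [exact: cvg_id|exact: cvg_cst].
by rewrite expr2; apply: cvg_trans (cvgM h h); apply: near_eq_cvg; near=> v; rewrite expr2.
Unshelve. all: by end_near. Qed.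

Lemma continuous_atan_lorentz b a :
  continuous (fun v => atan ((v - a) / b) : R).
Proof.
move=> u; apply: (@continuous_comp _ _ _ (fun v : R => (v - a) / b) (@atan R)).
  by apply: cvgM; [apply: cvgB; [exact: cvg_id|exact: cvg_cst]|exact: cvg_cst].
exact: continuous_atan.
Qed.

Lemma integral_lorentz_itv b a c d : 0 < b -> c < d ->
  (\int[mu]_(u in `[c, d]) (lorentz b a u)%:E
   = (atan ((d - a) / b) - atan ((c - a) / b))%:E)%E.
Proof.
move=> b0 cd.
rewrite (@continuous_FTC2 _ _ (fun v => atan ((v - a) / b))) //.
- by apply: continuous_in_subspaceT => x ?; exact: continuous_lorentz.
- split.
  + by move=> x _; have := is_derive_atan_lorentz a x b0; case.
  + by apply: cvg_at_right_filter; exact: continuous_atan_lorentz.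
  + by apply: cvg_at_left_filter; exact: continuous_atan_lorentz.
- move=> x _; rewrite derive1E; have h := is_derive_atan_lorentz a x b0.
  exact: derive_val.
Qed.

Lemma integral_lorentz_y b a c : 0 < b ->
  (\int[mu]_(u in `[c, +oo[) (lorentz b a u)%:E
   = (pi / 2 - atan ((c - a) / b))%:E)%E.
Proof.
move=> b0.
rewrite (@ge0_continuous_FTC2y _ _ (fun v => atan ((v - a) / b)) _ (pi / 2)) //.
- by move=> x _; exact: lorentz_ge0.
- by apply: continuous_in_subspaceT => x ?; exact: continuous_lorentz.
- apply: (cvg_comp _ _ _ (@cvgy_atan R)).
  apply/cvgryPge => A; near=> v.
  rewrite ler_pdivlMr // lerBrDr; near: v; apply: nbhs_pinfty_ge; exact: num_real.
- by apply: cvg_at_right_filter; exact: continuous_atan_lorentz.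
- move=> x _; rewrite derive1E; have h := is_derive_atan_lorentz a x b0.
  exact: derive_val.
Unshelve. all: by end_near. Qed.

Lemma measurable_lorentz b a : 0 < b -> measurable_fun setT (lorentz b a).
Proof. by move=> b0; apply: continuous_measurable_fun; exact: continuous_lorentz. Qed.

(** The line is cut at 0 and the negative half reflected, which moves the centre to [- a]. *)
Lemma integral_lorentz b a : 0 < b ->
  (\int[mu]_u (lorentz b a u)%:E = pi%:E)%E.
Proof.
move=> b0.
have mf (D : set R) : measurable_fun D (fun u => (lorentz b a u)%:E).
  by apply/measurable_EFinP; apply: measurable_funTS; exact: measurable_lorentz.
rewrite -(setUv `]-oo, 0%R]) ge0_integral_setU //=; last 4 first.
- exact: measurableC.
- exact: mf.
- by move=> x _; rewrite lee_fin lorentz_ge0.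
- by apply/disj_set2P; rewrite setICr.
rewrite setCitvl integral_itv_obnd_cbnd; last exact: mf.
rewrite integral_lorentz_y // -{1}oppr0 ge0_integration_by_substitutionNy; last 2 first.
- by apply: continuous_in_subspaceT => x ?; exact: continuous_lorentz.
- by move=> x _; exact: lorentz_ge0.
under eq_integral => u _.
  rewrite /= (_ : lorentz b a (- u) = lorentz b (- a) u); last first.
    by rewrite /lorentz; congr (_ / (_ + _)); ring.
  over.
rewrite integral_lorentz_y // -EFinD; congr (_%:E).
have -> : (0 - a) / b = - ((0 - - a) / b) by ring.
by rewrite atanN; lra.
Qed.

(** The function [atan v + 1/v] decreases on the positive axis, its derivative being
    [1/(1 + v^2) - 1/v^2]. *)
Lemma atan_diff_le (t u : R) : 0 < t -> t <= u -> atan u - atan t <= t^-1.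
Proof.
move=> t0; rewrite le_eqVlt => /predU1P[<-|tu].
  by rewrite subrr invr_ge0 ltW.
pose f := fun v : R => atan v + v^-1.
pose df := fun v : R => (1 + v ^+ 2)^-1 - v ^- 2.
have dfx (x : R) : 0 < x -> is_derive x 1 f (df x).
  move=> x0; have xn0 : x != 0 by rewrite gt_eqF.
  have h1 := is_derive1_atan x.
  have h2 := @is_deriveV _ id x 1 1 xn0 (is_derive_id _ _).
  have := is_deriveD h1 h2.
  by move=> /is_derive_eq; apply; rewrite /df scaleNr /GRing.scale /= mulr1.
have [||c] := @MVT _ f df t u tu.
- by move=> x; rewrite in_itv /= => /andP[tx _]; apply: dfx; exact: lt_trans tx.
- apply: continuous_in_subspaceT => x; rewrite inE /= in_itv /= => /andP[tx _].
  have x0 : 0 < x by apply: lt_le_trans tx.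
  by apply: differentiable_continuous; apply/derivable1_diffP; have [] := dfx x x0.
rewrite in_itv /= => /andP[tc _] fE.
have c0 : 0 < c by apply: lt_trans tc.
have : f u - f t <= 0.
  rewrite fE mulr_le0_ge0 ?subr_ge0 ?(ltW tu) // /df subr_le0 lef_pV2 ?posrE ?exprn_gt0 //.
    by rewrite lerDr.
  by rewrite ltr_wpDr ?sqr_ge0.
have : 0 <= u^-1 by rewrite invr_ge0 ltW // (lt_trans t0).
by rewrite /f; lra.
Qed.

Lemma atan_ge (t : R) : 0 < t -> pi / 2 - t^-1 <= atan t.
Proof.
move=> t0; rewrite lerBlDr.
apply: (cvgr_to_le (@cvgy_atan R)); near=> u.
rewrite -lerBlDl; apply: atan_diff_le => //.
Unshelve. all: by end_near. Qed.

Lemma integral_lorentz_itv_le_pi b a c d : 0 < b -> c < d ->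
  (\int[mu]_(u in `[c, d]) (lorentz b a u)%:E <= pi%:E)%E.
Proof.
move=> b0 cd; rewrite integral_lorentz_itv // lee_fin.
have := atan_ltpi2 ((d - a) / b); have := atan_gtNpi2 ((c - a) / b).
by lra.
Qed.

Lemma integral_lorentz_centered b a k : 0 < b -> 0 < k ->
  ((pi - 2 / k)%:E <= \int[mu]_(u in `[(a - k * b)%R, (a + k * b)%R]) (lorentz b a u)%:E)%E.
Proof.
move=> b0 k0; have kb0 : 0 < k * b by rewrite mulr_gt0.
have bn0 : b != 0 by rewrite gt_eqF.
rewrite integral_lorentz_itv //; last by lra.
have -> : (a + k * b - a) / b = k by field.
have -> : (a - k * b - a) / b = - k by field.
by rewrite atanN lee_fin; have := atan_ge k0; lra.
Qed.

(** Seen from [a] in units of [b], the interval starts at distance at least [t / b], beyond which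
    [atan] grows by at most [b / t]. A centre on the right reduces to one on the left by oddness. *)
Lemma integral_lorentz_far b a c d t : 0 < b -> c < d -> 0 < t ->
  a <= c - t \/ d + t <= a ->
  (\int[mu]_(u in `[c, d]) (lorentz b a u)%:E <= (b / t)%:E)%E.
Proof.
move=> b0 cd t0 far; rewrite integral_lorentz_itv // lee_fin.
have main (x y : R) : t / b <= x -> x <= y -> atan y - atan x <= b / t.
  move=> tx xy; have tb0 : 0 < t / b by rewrite divr_gt0.
  have x0 : 0 < x by apply: lt_le_trans tx.
  apply: le_trans (atan_diff_le x0 xy) _.
  by rewrite -invf_div lef_pV2 ?posrE.
case: far => far.
  apply: main; last by rewrite ler_pM2r ?invr_gt0 //; lra.
  by rewrite ler_pM2r ?invr_gt0 //; lra.
have h := main ((a - d) / b) ((a - c) / b).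
have -> : (d - a) / b = - ((a - d) / b) by ring.
have -> : (c - a) / b = - ((a - c) / b) by ring.
by rewrite !atanN opprK addrC; apply: h; rewrite ler_pM2r ?invr_gt0 //; lra.
Qed.

(** A Lorentzian of width at least [r] changes by a bounded factor under a shift by [r]: [(u - a)^2
    <= 2 (u - v)^2 + 2 (v - a)^2 <= 2 b^2 + 2 (v - a)^2]. *)
Lemma lorentz_harnack b a r u v : 0 < r -> r <= b -> `|u - v| <= r ->
  lorentz b a v <= 3 * lorentz b a u.
Proof.
move=> r0 rb uv; have b0 : 0 < b by apply: lt_le_trans rb.
have d1 := lorentz_den_gt0 a u b0; have d2 := lorentz_den_gt0 a v b0.
rewrite /lorentz mulrA ler_pdivrMr // mulrAC ler_pdivlMr //.
have h : (u - v) ^+ 2 <= b ^+ 2.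
  rewrite -real_normK ?num_real // ler_sqr ?nnegrE ?(ltW b0) //.
  exact: le_trans rb.
have -> : b * ((u - a) ^+ 2 + b ^+ 2) = ((u - a) ^+ 2 + b ^+ 2) * b by ring.
have -> : 3 * b * ((v - a) ^+ 2 + b ^+ 2) = (3 * ((v - a) ^+ 2 + b ^+ 2)) * b by ring.
rewrite ler_wpM2r ?(ltW b0) //.
have e : (u - a) ^+ 2 = 2 * (u - v) ^+ 2 + 2 * (v - a) ^+ 2 - (u - v - (v - a)) ^+ 2.
  by ring.
have := sqr_ge0 (u - v - (v - a)); have := sqr_ge0 (v - a).
lra.
Qed.

End Lorentz.

(** * Spectral averaging *)

Section Measurability.
Context d (T : measurableType d) (R : realType).

Lemma measurable_inv : measurable_fun setT (@GRing.inv R : R -> R).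
Proof.
rewrite -(setvU [set 0 : R]); apply/measurable_funU => //.
  exact: measurableC.
split; last exact: measurable_fun_set1.
apply: open_continuous_measurable_fun.
  by apply: closed_openC; exact: closed_eq.
by move=> x /set_mem /= /eqP x0; exact: inv_continuous.
Qed.

Lemma measurable_funV (f : T -> R) :
  measurable_fun setT f -> measurable_fun setT (fun t => (f t)^-1).
Proof. by move=> mf; exact: measurableT_comp measurable_inv mf. Qed.

Lemma measurable_lorentz_comp (b a u : T -> R) : measurable_fun setT b ->
  measurable_fun setT a -> measurable_fun setT u ->
  measurable_fun setT (fun t => lorentz (b t) (a t) (u t)).
Proof.
move=> mb ma mu; apply: measurable_funM => //; apply: measurable_funV.
by apply: measurable_funD; apply: measurable_funX => //; exact: measurable_funB.
Qed.

Section Matrices.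
Variable n : nat.

Lemma measurable_det m (A : T -> 'M[R]_m) :
  (forall i j, measurable_fun setT (fun t => A t i j)) ->
  measurable_fun setT (fun t => \det (A t)).
Proof.
move=> mA; rewrite /determinant; apply: measurable_sum => s.
apply: measurable_funM; first exact: measurable_cst.
by apply: measurable_prod => i _; exact: mA.
Qed.

Lemma measurable_mulmx m p (A : T -> 'M[R]_(n, m)) (B : T -> 'M[R]_(m, p)) :
  (forall i j, measurable_fun setT (fun t => A t i j)) ->
  (forall i j, measurable_fun setT (fun t => B t i j)) ->
  forall i j, measurable_fun setT (fun t => (A t *m B t) i j).
Proof.
move=> mA mB i j; under eq_fun => t do rewrite mxE.
by apply: measurable_sum => k; exact: measurable_funM.
Qed.

Lemma measurable_shift (H : T -> 'M[R]_n) (E : R) :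
  (forall i j, measurable_fun setT (fun t => H t i j)) ->
  forall i j, measurable_fun setT (fun t => (H t - E%:M) i j).
Proof.
move=> mH i j; under eq_fun => t do rewrite !mxE.
by apply: measurable_funB => //; exact: measurable_cst.
Qed.

(** The matrix [resA] is invertible for every [t], so the cofactor formula applies throughout and
    the entries are quotients of polynomials. *)
Lemma measurable_resK (H : T -> 'M[R]_n) (E r : R) : 0 < r ->
  (forall t, (H t)^T = H t) ->
  (forall i j, measurable_fun setT (fun t => H t i j)) ->
  forall i j, measurable_fun setT (fun t => resK (H t) E r i j).
Proof.
move=> r0 sH mH i j.
have mA k l : measurable_fun setT (fun t => resA (H t) E r k l).
  under eq_fun => t do rewrite mxE.
  apply: measurable_funD; last exact: measurable_cst.
  by apply: measurable_mulmx => *; exact: measurable_shift.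
under eq_fun => t do rewrite /resK /invmx resA_unit // !mxE.
apply: measurable_funM; first exact/measurable_funV/measurable_det.
rewrite /cofactor; apply: measurable_funM; first exact: measurable_cst.
by apply: measurable_det => k l; under eq_fun => t do rewrite 2!mxE; exact: mA.
Qed.

Lemma measurable_lor (H : T -> 'M[R]_n) (E r : R) x : 0 < r ->
  (forall t, (H t)^T = H t) ->
  (forall i j, measurable_fun setT (fun t => H t i j)) ->
  measurable_fun setT (fun t => lor (H t) E r x).
Proof.
move=> r0 sH mH; apply: measurable_funM; first exact: measurable_cst.
exact: measurable_resK.
Qed.

Lemma measurable_pole (H : T -> 'M[R]_n) (E r : R) x : 0 < r ->
  (forall t, (H t)^T = H t) ->
  (forall i j, measurable_fun setT (fun t => H t i j)) ->
  measurable_fun setT (fun t => polea (H t) E r x) /\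
  measurable_fun setT (fun t => poleb (H t) E r x).
Proof.
move=> r0 sH mH.
have mK := measurable_resK E r0 sH mH.
have mq : measurable_fun setT (fun t => poleq (H t) E r x).
  by apply: measurable_funM => //; exact: measurable_cst.
have mp : measurable_fun setT (fun t => polep (H t) E r x).
  by apply: measurable_mulmx => // *; exact: measurable_shift.
have mm : measurable_fun setT (fun t => polem (H t) E r x).
  by apply: measurable_funD; exact: measurable_funX.
split; apply: measurable_funM; try exact: measurable_funV.
  exact: measurable_funN.
exact: mq.
Qed.

End Matrices.
End Measurability.

Section SpectralAveraging.
Local Open Scope ereal_scope.
Context d (Omega : measurableType d) (R : realType) (P : probability Omega R).
Variables (G : set (set Omega)) (X : Omega -> R) (c : R).
Hypotheses (mG : G `<=` measurable) (mX : measurable_fun setT X)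
  (c0 : (0 <= c)%R).
Hypothesis dom : forall I B, measurable I -> <<s G >> B ->
  P (X @^-1` I `&` B) <= c%:E * lebesgue_measure I * P B.
Local Notation GT := (g_sigma_algebraType G).
Local Notation mu := (@lebesgue_measure R).

(** Conditioning on [<<s G>>] is expressed through [GT], the same points with the coarser
    sigma-algebra; measures are pushed to it along the identity. *)
Lemma measurable_coarse_id : @measurable_fun _ _ Omega GT setT id.
Proof.
move=> _ B mB; rewrite setTI; apply: (smallest_sub _ mG mB).
exact: sigma_algebra_measurable.
Qed.

Lemma measurable_coarse d' (T' : sigmaRingType d') (f : GT -> T') :
  @measurable_fun _ _ GT T' setT f -> @measurable_fun _ _ Omega T' setT f.
Proof.
move=> mf _ B mB; have := mf measurableT B mB; rewrite setTI => h.
by have := measurable_coarse_id measurableT h; rewrite setTI.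
Qed.

(** On [GT], hypothesis [dom] compares two measures, [P] restricted to the event that [X] lies in
    [I] and [c t P]. Integrals of nonnegative functions inherit the comparison. *)
Lemma integral_dom (I : set R) (t : R) (g : GT -> \bar R) :
  measurable I -> (0 <= t)%R -> mu I = t%:E ->
  measurable_fun setT g -> (forall w, 0 <= g w) ->
  \int[P]_(w in X @^-1` I) g w <= (c * t)%:E * \int[P]_w g w.
Proof.
move=> mI t0 It mg g0.
have mXI : measurable (X @^-1` I) by rewrite -[_ @^-1` _]setTI; exact: mX.
have ct0 : (0 <= c * t)%R by rewrite mulr_ge0.
have mg' := measurable_coarse mg.
pose m1 := mrestr P mXI.
have -> : \int[P]_(w in X @^-1` I) g w = \int[m1]_(w in X @^-1` I) g w.
  by apply: eq_measure_integral => A mA AI; rewrite /m1 /= /mrestr setIidl.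
apply: (@le_trans _ _ (\int[m1]_w g w)).
  by apply: ge0_subset_integral.
pose m1f : {measure set GT -> \bar R} := pushforward m1 (id : Omega -> GT).
pose pPf : {measure set GT -> \bar R} := pushforward P (id : Omega -> GT).
pose m1' := m1f measurable_coarse_id.
pose m2' : {measure set GT -> \bar R} :=
  mscale (NngNum ct0) (pPf measurable_coarse_id).
have -> : \int[m1]_w g w = \int[m1']_w g w.
  by rewrite ge0_integral_pushforward //; exact: measurable_coarse_id.
have -> : (c * t)%:E * \int[P]_w g w = \int[m2']_w g w.
  rewrite ge0_integral_mscale //= ge0_integral_pushforward //.
  exact: measurable_coarse_id.
apply: ge0_le_measure_integral => // B mB.
rewrite /m1' /m2' /= /mscale /= /pushforward /m1 /mrestr /= setIC EFinM -It.
exact: dom.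
Qed.

(** The conditional law of [X] is never disintegrated. By [lorentz_harnack], the Lorentzian at [X]
    is at most 3 times its mean over the ball of radius [r] around [X]. After Tonelli, for fixed
    [u], the event that [X] is within [r] of [u] has conditional probability at most [2 r c], and
    integrating the Lorentzian over [u] leaves [pi]. *)
Lemma spectral_averaging (r : R) (al be g : GT -> R) : (0 < r)%R ->
  measurable_fun setT al -> measurable_fun setT be -> measurable_fun setT g ->
  (forall w, r <= be w)%R -> (forall w, 0 <= g w)%R ->
  \int[P]_w (lorentz (be w) (al w) (X w) * g w)%:E
  <= (3 * pi * c)%:E * \int[P]_w (g w)%:E.
Proof.
move=> r0 mal mbe mg ber g0.
have be0 w : (0 < be w)%R by apply: lt_le_trans (ber w).
have r20 : (0 < 2 * r)%R by rewrite mulr_gt0.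
have mal' := measurable_coarse mal; have mbe' := measurable_coarse mbe.
have mg' := measurable_coarse mg.
pose S := [set p : Omega * R | `|X p.1 - p.2| <= r]%R.
have mS : measurable S.
  have h : measurable_fun setT (fun p : Omega * R => `|X p.1 - p.2|%R).
    apply: measurableT_comp => //; apply: measurable_funB => //.
    exact: measurableT_comp mX measurable_fst.
  have := h measurableT `]-oo, r]%classic (measurable_itv _).
  by rewrite setTI (_ : _ @^-1` _ = S).
pose L (p : Omega * R) := lorentz (be p.1) (al p.1) p.2.
have mL : measurable_fun setT L.
  apply: measurable_lorentz_comp; last exact: measurable_snd.
  - exact: (measurableT_comp mbe' measurable_fst).
  - exact: (measurableT_comp mal' measurable_fst).
have L0 p : (0 <= L p)%R by exact: lorentz_ge0.
pose F (p : Omega * R) := (L p * g p.1 * \1_S p)%:E.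
have mF : measurable_fun setT F.
  apply/measurable_EFinP; apply: measurable_funM => //.
  apply: measurable_funM => //.
  exact: (measurableT_comp mg' measurable_fst).
have F0 p : 0 <= F p.
  by rewrite lee_fin mulr_ge0 // mulr_ge0.
pose F2 (p : Omega * R) := (L p * g p.1)%:E.
have mF2 : measurable_fun setT F2.
  apply/measurable_EFinP; apply: measurable_funM => //.
  exact: (measurableT_comp mg' measurable_fst).
have F20 p : 0 <= F2 p by rewrite lee_fin mulr_ge0.
have SE (w : Omega) u : ((w, u) \in S) = (u \in `[(X w - r)%R, (X w + r)%R]).
  rewrite in_itv /=; apply/idP/idP.
    by rewrite inE /S /= distrC ler_distl.
  by rewrite inE /S /= distrC ler_distl.
have mu_ball a : mu `[(a - r)%R, (a + r)%R]%classic = (2 * r)%:E.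
  rewrite lebesgue_measure_itv /= lte_fin ifT; last by lra.
  by rewrite -EFinD; congr (_%:E); ring.
have step1 (w : Omega) : ((2 * r) * (lorentz (be w) (al w) (X w) * g w))%:E
    <= 3%:E * \int[mu]_u F (w, u).
  pose D : set R := `[(X w - r)%R, (X w + r)%R]%classic.
  have mD : measurable D by exact: measurable_itv.
  have -> : \int[mu]_u F (w, u) = \int[mu]_(u in D) F2 (w, u).
    rewrite [RHS]integral_mkcond; apply: eq_integral => u _.
    rewrite patchE /F /F2 indicE SE.
    rewrite (_ : (u \in D) = (u \in `[(X w - r)%R, (X w + r)%R])); last first.
      by rewrite /D mem_setE.
    by case: ifP => _; rewrite ?mulr1 ?mulr0.
  have mF2w : measurable_fun setT (fun u => F2 (w, u)).
    exact: (measurableT_comp mF2 (pair1_measurable w)).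
  have -> : ((2 * r) * (lorentz (be w) (al w) (X w) * g w))%:E
      = \int[mu]_(u in D) (lorentz (be w) (al w) (X w) * g w)%:E.
    transitivity ((lorentz (be w) (al w) (X w) * g w)%:E * (2 * r)%:E).
      by rewrite -EFinM mulrC.
    rewrite -(mu_ball (X w)); apply/esym.
    exact: integral_cst.
  rewrite -ge0_integralZl //; last first.
    exact: measurable_funTS.
  apply: ge0_le_integral => //.
  - by move=> u _; rewrite lee_fin mulr_ge0 // lorentz_ge0.
  - by apply: measurable_funTS; exact: measurable_funeM.
  - move=> u Du; rewrite -EFinM lee_fin mulrA ler_wpM2r //.
    apply: (@lorentz_harnack _ _ _ r) => //.
    by move: Du; rewrite /D /= in_itv /= ler_distl; lra.
have step3 u : \int[P]_w F (w, u)
    <= (c * (2 * r))%:E * \int[P]_w F2 (w, u).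
  pose I : set R := `[(u - r)%R, (u + r)%R]%classic.
  have mI : measurable I by exact: measurable_itv.
  have -> : \int[P]_w F (w, u) = \int[P]_(w in X @^-1` I) F2 (w, u).
    rewrite [RHS]integral_mkcond; apply: eq_integral => w _.
    rewrite patchE /F /F2 indicE SE.
    rewrite (_ : (w \in X @^-1` I) = (u \in `[(X w - r)%R, (X w + r)%R])).
      by case: ifP => _; rewrite ?mulr1 ?mulr0.
    by apply/idP/idP; rewrite inE /= /I /= !in_itv /=; lra.
  apply: (@integral_dom I (2 * r)%R (fun w => F2 (w, u))) => //.
  - exact: ltW.
  - exact: mu_ball.
  - apply/measurable_EFinP; apply: measurable_funM => //.
    by apply: measurable_lorentz_comp => //; exact: measurable_cst.
have main : (2 * r)%:E * \int[P]_w (lorentz (be w) (al w) (X w) * g w)%:E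
    <= (2 * r)%:E * ((3 * pi * c)%:E * \int[P]_w (g w)%:E).
  have mXL : measurable_fun setT
      (fun w : Omega => (lorentz (be w) (al w) (X w) * g w)%:E).
    apply/measurable_EFinP; apply: measurable_funM => //.
    exact: measurable_lorentz_comp.
  rewrite -ge0_integralZl //; last 2 first.
  - by move=> w _; rewrite lee_fin mulr_ge0 // lorentz_ge0.
  - by rewrite lee_fin ltW.
  apply: (@le_trans _ _ (\int[P]_w (3%:E * \int[mu]_u F (w, u)))).
    apply: ge0_le_integral => //.
    - by move=> w _; rewrite -EFinM lee_fin mulr_ge0 ?(ltW r20) // mulr_ge0 // lorentz_ge0.
    - exact: measurable_funeM.
    - apply: measurable_funeM.
      exact: (@measurable_fun_fubini_tonelli_F _ _ _ _ _ mu F).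
    - by move=> w _; rewrite -EFinM; exact: step1.
  rewrite ge0_integralZl //; last 2 first.
  - exact: (@measurable_fun_fubini_tonelli_F _ _ _ _ _ mu F).
  - by move=> w _; exact: integral_ge0.
  have -> : \int[P]_w \int[mu]_u F (w, u) = \int[mu]_u \int[P]_w F (w, u).
    exact: (@fubini_tonelli _ _ _ _ R P mu F).
  apply: (@le_trans _ _
      (3%:E * \int[mu]_u ((c * (2 * r))%:E * \int[P]_w F2 (w, u)))).
    apply: lee_wpmul2l => //; apply: ge0_le_integral => //.
    - by move=> u _; exact: integral_ge0.
    - exact: (@measurable_fun_fubini_tonelli_G _ _ _ _ _ P F).
    - apply: measurable_funeM.
      exact: (@measurable_fun_fubini_tonelli_G _ _ _ _ _ P F2).
  rewrite ge0_integralZl //; last 3 first.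
  - exact: (@measurable_fun_fubini_tonelli_G _ _ _ _ _ P F2).
  - by move=> u _; exact: integral_ge0.
  - by rewrite lee_fin mulr_ge0 // ltW.
  have -> : \int[mu]_u \int[P]_w F2 (w, u) = \int[P]_w \int[mu]_u F2 (w, u).
    by apply/esym; exact: (@fubini_tonelli _ _ _ _ R P mu F2).
  have -> : \int[P]_w \int[mu]_u F2 (w, u) = pi%:E * \int[P]_w (g w)%:E.
    rewrite -ge0_integralZl //; last 3 first.
    - exact/measurable_EFinP.
    - by move=> w _; rewrite lee_fin.
    - by rewrite lee_fin pi_ge0.
    apply: eq_integral => w _.
    under eq_integral => u _ do rewrite /F2 /= EFinM muleC.
    rewrite ge0_integralZl //=; last 3 first.
    - by apply/measurable_EFinP; exact: (@measurable_lorentz _ (be w) (al w)).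

    - by move=> u _; rewrite lee_fin L0.
    - by rewrite lee_fin.
    by rewrite /L /= integral_lorentz // muleC.
  rewrite !muleA -!EFinM le_eqVlt; apply/orP; left; apply/eqP.
  by congr (_%:E * _); ring.
by move: main; rewrite lee_pmul2l ?lte_fin.
Qed.

End SpectralAveraging.

(** * Decoupling of independent sigma-algebras *)

Section Decoupling.
Local Open Scope ereal_scope.
Context d (Omega : measurableType d) (R : realType) (P : probability Omega R).
Variables (G1 G2 : set (set Omega)).
Hypotheses (mG1 : G1 `<=` measurable) (mG2 : G2 `<=` measurable).
Hypothesis indep : forall A B, <<s G1 >> A -> <<s G2 >> B ->
  P (A `&` B) = P A * P B.
Local Notation T1 := (g_sigma_algebraType G1).
Local Notation T2 := (g_sigma_algebraType G2).

(** By independence, the law of [(w, w)] on [T1 * T2] agrees on rectangles with the product of its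
    marginals, hence equals it; Tonelli then splits the integral. *)
Lemma integral_decouple (F : T1 * T2 -> \bar R) :
  measurable_fun setT F -> (forall p, 0 <= F p) ->
  \int[P]_w F (w, w) = \int[P]_w1 \int[P]_w2 F (w1, w2).
Proof.
move=> mF F0.
have m1 := measurable_coarse_id mG1; have m2 := measurable_coarse_id mG2.
pose X1 : {mfun Omega >-> T1} := HB.pack (id : Omega -> T1)
  (isMeasurableFun.Build _ _ _ _ _ m1).
pose X2 : {mfun Omega >-> T2} := HB.pack (id : Omega -> T2)
  (isMeasurableFun.Build _ _ _ _ _ m2).
pose P1 := distribution P X1.
pose P2 := distribution P X2.
have mD : @measurable_fun _ _ Omega (T1 * T2)%type setT (fun w => (w, w)).
  exact: measurable_fun_pair.
pose mf : {measure set (T1 * T2) -> \bar R} :=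
  pushforward P (fun w : Omega => (w, w) : T1 * T2).
pose m' := mf mD.
have -> : \int[P]_w F (w, w) = \int[m']_p F p.
  by rewrite ge0_integral_pushforward.
have -> : \int[m']_p F p = \int[P1 \x P2]_p F p.
  apply: eq_measure_integral => A mA _; apply/esym.
  by apply: product_measure_unique => // B C mB mC; exact: indep.
rewrite fubini_tonelli1 //.
rewrite ge0_integral_pushforward //.
- apply: eq_integral => w _ /=; rewrite /fubini_F ge0_integral_pushforward //.
  exact: measurableT_comp.
- exact: measurable_fun_fubini_tonelli_F.
- by move=> w _; exact: integral_ge0.
Qed.

End Decoupling.

(** * Wegner and Minami estimates *)

Section Generators.
Context d (Omega : measurableType d) (R : realType) (I : Type).
Variable f : I -> Omega -> R.

(** The generating family of [sigma_gen], kept unclosed because [g_sigma_algebraType] takes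
    generators. *)
Definition sigma_gens : set (set Omega) :=
  [set A | exists i (J : set R), measurable J /\ A = f i @^-1` J].

Lemma sigma_gens_measurable :
  (forall i, measurable_fun setT (f i)) -> sigma_gens `<=` measurable.
Proof.
by move=> mf _ [i [J [mJ ->]]]; rewrite -[_ @^-1` _]setTI; exact: mf.
Qed.

Lemma measurable_sigma_gens i :
  @measurable_fun _ _ (g_sigma_algebraType sigma_gens) _ setT (f i).
Proof.
move=> _ J mJ; rewrite setTI; apply: sub_sigma_algebra.
by exists i, J.
Qed.

End Generators.

Section FixedHopping.
Local Open Scope ereal_scope.
Context d (Omega : measurableType d) (R : realType) (P : probability Omega R).
Variables (n : nat) (V : 'I_n -> Omega -> R) (c : R).
Hypotheses (mV : forall x, measurable_fun setT (V x)) (c0 : (0 <= c)%R).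

Definition others (x : 'I_n) (y : {y : 'I_n | y != x}) : Omega -> R :=
  V (sval y).

Hypothesis dom : forall (x : 'I_n) (I : set R) (B : set Omega), measurable I ->
  sigma_gen (others (x := x)) B ->
  P (V x @^-1` I `&` B) <= c%:E * lebesgue_measure I * P B.

Local Notation GT x := (g_sigma_algebraType (sigma_gens (others (x := x)))).

Lemma others_measurable x : sigma_gens (others (x := x)) `<=` measurable.
Proof. by apply: sigma_gens_measurable => y; exact: mV. Qed.

Lemma measurable_other x y : y != x ->
  @measurable_fun _ _ (GT x) _ setT (V y).
Proof.
move=> yx; exact: (@measurable_sigma_gens _ _ _ _ (others (x := x)) (Sub y yx)).
Qed.

(** By [lor_rank1] the entry is [2 r] times a Lorentzian in [V x] whose centre and width depend on
    [H0] only; [spectral_averaging] gives the constant [2 r * 3 pi c]. The weight [g] is there for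
    [minami]. *)
Lemma wegner_weighted x (H0 : Omega -> 'M[R]_n) (g : Omega -> R) (E r : R) :
  (0 < r)%R -> (forall w, (H0 w)^T = H0 w) ->
  (forall i j, @measurable_fun _ _ (GT x) _ setT (fun w => H0 w i j)) ->
  @measurable_fun _ _ (GT x) _ setT g -> (forall w, 0 <= g w)%R ->
  \int[P]_w (lor (H0 w + V x w *: delta_mx x x) E r x * g w)%:E
  <= (6 * pi * c * r)%:E * \int[P]_w (g w)%:E.
Proof.
move=> r0 sH mH mg g0.
have [ma mb] := @measurable_pole _ (GT x) R n H0 E r x r0 sH mH.
have bE w := @poleb_ge _ _ (H0 w) E r x (sH w) r0.
have mgO := measurable_coarse (@others_measurable x) mg.
have maO := measurable_coarse (@others_measurable x) ma.
have mbO := measurable_coarse (@others_measurable x) mb.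
have := @spectral_averaging _ Omega R P _ (V x) c (@others_measurable x)
  (mV x) c0 (@dom x) r _ _ g r0 ma mb mg bE g0.
move=> /(lee_wpmul2l (_ : 0 <= (2 * r)%:E)) h.
have {h} := h ltac:(by rewrite lee_fin mulr_ge0 // ltW).
rewrite -ge0_integralZl //; last 3 first.
- apply/measurable_EFinP; apply: measurable_funM => //.
  exact: measurable_lorentz_comp.
- move=> w _; rewrite lee_fin mulr_ge0 // lorentz_ge0 //.
  exact: lt_le_trans (bE w).
- by rewrite lee_fin mulr_ge0 // ltW.
rewrite muleA -EFinM.
have -> : (2 * r * (3 * pi * c) = 6 * pi * c * r)%R by ring.
apply: le_trans; rewrite le_eqVlt; apply/orP; left; apply/eqP.
apply: eq_integral => w _; rewrite lor_rank1 // -EFinM; congr (_%:E).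
by rewrite /lorentz -!mulrA.
Qed.

(** Removing the value at [x] leaves a Hamiltonian measurable with respect to the other sites. *)
Definition zero_at (x : 'I_n) (v : 'I_n -> R) : 'I_n -> R :=
  fun z => if z == x then 0%R else v z.

Lemma Hmat_zero_at (t : 'M[R]_n) v x :
  (Hmat t v = Hmat t (zero_at x v) + v x *: delta_mx x x)%R.
Proof.
apply/matrixP => i j; rewrite !mxE /zero_at -addrA; congr (_ + _)%R.
case: (eqVneq i j) => [<-|ij].
  by rewrite andbb; case: eqVneq => [->|]; rewrite !mulr1n ?add0r ?mulr1 ?mulr0 ?addr0.
rewrite !mulr0n add0r; case: (eqVneq i x) => [<-|]; last by rewrite mulr0.
by rewrite eq_sym (negPf ij) mulr0.
Qed.

Lemma Hmat_sym (t : 'M[R]_n) v : t^T = t -> (Hmat t v)^T = Hmat t v.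
Proof. by move=> st; rewrite /Hmat linearD /= st tr_diag_mx. Qed.

Lemma strip_zero_at (t : 'M[R]_n) v x :
  strip (Hmat t v) x = strip (Hmat t (zero_at x v)) x.
Proof.
apply/matrixP => i j; rewrite !mxE; case: ifP => // /negbT.
by rewrite negb_or /zero_at => /andP[/negPf ->].
Qed.

Lemma strip_Hmat_zero_at (t : 'M[R]_n) v x y : y != x ->
  (strip (Hmat t v) x = strip (Hmat t (zero_at y v)) x + v y *: delta_mx y y)%R.
Proof.
move=> yx; rewrite {1}(Hmat_zero_at t v y); apply/matrixP => i j.
rewrite [LHS]mxE [RHS]mxE [X in (_ = X + _)%R]mxE.
case: ifP => [ijx|_]; last by rewrite mxE.
rewrite add0r !mxE; case: (eqVneq i y) => [iy|_]; last by rewrite mulr0.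
case: (eqVneq j y) => [jy|_]; last by rewrite mulr0.
by move: ijx; rewrite iy jy (negPf yx).
Qed.

Variable t : 'M[R]_n.
Hypothesis st : t^T = t.

Lemma measurable_Hmat_zero_at x i j :
  @measurable_fun _ _ (GT x) _ setT (fun w => Hmat t (zero_at x (V ^~ w)) i j).
Proof.
apply: (@eq_measurable_fun _ _ (GT x) _ _
    (fun w => t i j + zero_at x (V ^~ w) i *+ (i == j))%R).
  by move=> w _; rewrite !mxE.
apply: measurable_funD; first exact: measurable_cst.
case: (i == j); last exact: measurable_cst.
rewrite /zero_at; case: eqVneq => [_|jx]; first exact: measurable_cst.
exact: measurable_other.
Qed.

Lemma measurable_strip d' (T' : measurableType d') (H : T' -> 'M[R]_n) x :
  (forall i j, measurable_fun setT (fun w => H w i j)) ->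
  forall i j, measurable_fun setT (fun w => strip (H w) x i j).
Proof.
move=> mH i j; under eq_fun => w do rewrite mxE.
by case: ((i == x) || (j == x)); [exact: measurable_cst|exact: mH].
Qed.

Lemma wegner x (E r : R) : (0 < r)%R ->
  \int[P]_w (lor (Hmat t (V ^~ w)) E r x)%:E <= (6 * pi * c * r)%:E.
Proof.
move=> r0.
have := @wegner_weighted x (fun w => Hmat t (zero_at x (V ^~ w))) (cst 1%R) E r r0.
move=> h.
have {}h := h (fun w => Hmat_sym _ st) (@measurable_Hmat_zero_at x)
  (measurable_cst _) (fun _ => ler01).
have e1 : \int[P]_w (cst 1%R w : R)%:E = 1.
  transitivity (1 * P setT); first exact: (integral_cst P measurableT 1).
  by rewrite probability_setT mule1.
move: h; rewrite e1 mule1; apply: le_trans.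
rewrite le_eqVlt; apply/orP; left; apply/eqP; apply: eq_integral => w _.
by rewrite mulr1 -Hmat_zero_at.
Qed.

Lemma wegner_strip x y (E r : R) : (0 < r)%R -> y != x ->
  \int[P]_w (lor (strip (Hmat t (V ^~ w)) x) E r y)%:E <= (6 * pi * c * r)%:E.
Proof.
move=> r0 yx.
have h := @wegner_weighted y (fun w => strip (Hmat t (zero_at y (V ^~ w))) x)
  (cst 1%R) E r r0.
have {}h := h (fun w => strip_sym x (Hmat_sym _ st))
  (measurable_strip _ (@measurable_Hmat_zero_at y))
  (measurable_cst _) (fun _ => ler01).
have e1 : \int[P]_w (cst 1%R w : R)%:E = 1.
  transitivity (1 * P setT); first exact: (integral_cst P measurableT 1).
  by rewrite probability_setT mule1.
move: h; rewrite e1 mule1; apply: le_trans.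
rewrite le_eqVlt; apply/orP; left; apply/eqP; apply: eq_integral => w _.
by rewrite mulr1 -strip_Hmat_zero_at.
Qed.

(** The stripped factor does not depend on [V x], so it can be the weight in [wegner_weighted]. Its
    own expectation is bounded by a Wegner estimate at each [y != x], whence the factor [n]. *)
Lemma minami x (E r : R) : (0 < r)%R ->
  \int[P]_w (lor (Hmat t (V ^~ w)) E r x *
     \sum_(y | y != x) lor (strip (Hmat t (V ^~ w)) x) E r y)%:E
  <= (n%:R * (6 * pi * c * r) ^+ 2)%:E.
Proof.
move=> r0; have a0 : (0 <= 6 * pi * c * r)%R.
  by rewrite !mulr_ge0 ?pi_ge0 // ltW.
pose H0 w := Hmat t (zero_at x (V ^~ w)).
have sH0 w : (H0 w)^T = H0 w by exact: Hmat_sym.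
have mL y : @measurable_fun _ _ (GT x) _ setT
    (fun w => lor (strip (H0 w) x) E r y).
  apply: measurable_lor => //; first by move=> w; exact: strip_sym.
  by apply: measurable_strip; exact: measurable_Hmat_zero_at.
have h := @wegner_weighted x H0
  (fun w => \sum_(y | y != x) lor (strip (H0 w) x) E r y)%R E r r0 sH0
  (@measurable_Hmat_zero_at x).
have {}h : \int[P]_w (lor (H0 w + V x w *: delta_mx x x) E r x *
     \sum_(y | y != x) lor (strip (H0 w) x) E r y)%:E
  <= (6 * pi * c * r)%:E * \int[P]_w (\sum_(y | y != x) lor (strip (H0 w) x) E r y)%:E.
  apply: h.
    apply: (@eq_measurable_fun _ _ (GT x) _ _ (fun w =>
        \sum_y if y != x then lor (strip (H0 w) x) E r y else 0)%R).
      by move=> w _; rewrite -big_mkcond.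
    apply: measurable_sum => y; case: (y != x); [exact: mL|exact: measurable_cst].
  by move=> w; apply: sumr_ge0 => y _; apply: lor_ge0 => //; exact: strip_sym.
apply: (@le_trans _ _ ((6 * pi * c * r)%:E * \int[P]_w
  (\sum_(y | y != x) lor (strip (H0 w) x) E r y)%:E)).
  apply: le_trans h; rewrite le_eqVlt; apply/orP; left; apply/eqP.
  by apply: eq_integral => w _; rewrite -Hmat_zero_at -strip_zero_at.
have -> : (n%:R * (6 * pi * c * r) ^+ 2 = (6 * pi * c * r) * (n%:R * (6 * pi * c * r)))%R.
  by ring.
rewrite [X in _ <= X]EFinM; apply: lee_wpmul2l; first by rewrite lee_fin.
under eq_integral => w _ do rewrite -sumEFin big_mkcond /=.
rewrite ge0_integral_sum //; last 2 first.
- move=> y; case: (y != x); last exact: measurable_cst.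
  apply/measurable_EFinP.
  exact: (measurable_coarse (@others_measurable x) (mL y)).
- move=> y w _; case: ifP => // _; rewrite lee_fin; apply: lor_ge0 => //.
  exact: strip_sym.
apply: (@le_trans _ _ (\sum_(y < n) (6 * pi * c * r)%:E)).
  apply: lee_sum => y _; case: (boolP (y != x)) => [yx|_]; last by rewrite integral0 lee_fin.
  apply: le_trans (wegner_strip E r0 yx); rewrite le_eqVlt; apply/orP; left.
  by apply/eqP; apply: eq_integral => w _; rewrite -strip_zero_at.
by rewrite sumEFin lee_fin sumr_const card_ord [leRHS]mulr_natl.
Qed.

End FixedHopping.

(** * Wegner and Minami estimates with random hopping *)

Section RandomHopping.
Local Open Scope ereal_scope.
Context d (Omega : measurableType d) (R : realType) (P : probability Omega R).
Variables (n : nat) (T : Omega -> 'M[R]_n) (V : 'I_n -> Omega -> R) (c : R).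
Hypotheses (mT : forall i j, measurable_fun setT (fun w => T w i j))
  (sT : forall w, (T w)^T = T w)
  (mV : forall x, measurable_fun setT (V x)) (c0 : (0 <= c)%R).
Hypothesis indep : forall A B,
  sigma_gen (fun ij : 'I_n * 'I_n => fun w => T w ij.1 ij.2) A ->
  sigma_gen V B -> P (A `&` B) = P A * P B.
Hypothesis dom : forall (x : 'I_n) (I : set R) (B : set Omega), measurable I ->
  sigma_gen (fun y : {y : 'I_n | y != x} => V (sval y)) B ->
  P (V x @^-1` I `&` B) <= c%:E * lebesgue_measure I * P B.

Let entries := fun ij : 'I_n * 'I_n => fun w => T w ij.1 ij.2.
Local Notation ham w := (Hmat (T w) (V ^~ w)).

Local Notation TV := (g_sigma_algebraType (sigma_gens entries) *
  g_sigma_algebraType (sigma_gens V))%type.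

(** By independence [T] can be frozen while [V] is averaged, so a bound uniform over deterministic
    hopping suffices. Measurability of [phi] is asked over all measurable types because it is used
    on the product of the two generated sigma-algebras. *)
Lemma integral_ham_le (phi : 'M[R]_n -> R) (K : R) :
  (forall d' (T' : measurableType d') (H : T' -> 'M[R]_n),
    (forall p, (H p)^T = H p) ->
    (forall i j, measurable_fun setT (fun p => H p i j)) ->
    measurable_fun setT (fun p => phi (H p))) ->
  (forall H, H^T = H -> 0 <= phi H)%R ->
  (forall t, t^T = t -> \int[P]_w (phi (Hmat t (V ^~ w)))%:E <= K%:E) ->
  \int[P]_w (phi (ham w))%:E <= K%:E.
Proof.
move=> mphi phi0 phiK.
have mG1 : sigma_gens entries `<=` measurable.
  by apply: sigma_gens_measurable => -[i j]; exact: mT.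
have mG2 : sigma_gens V `<=` measurable by exact: sigma_gens_measurable.
pose F (p : TV) :=
  (phi (Hmat (T p.1) (V ^~ p.2)))%:E.
have mF : measurable_fun setT F.
  apply/measurable_EFinP; apply: mphi => [p|i j]; first exact: Hmat_sym.
  apply: (@eq_measurable_fun _ _ TV R _
    (fun p : TV => T p.1 i j + V i p.2 *+ (i == j))%R).
    by move=> w _; rewrite !mxE.
  apply: measurable_funD.
    have h : @measurable_fun _ _ (g_sigma_algebraType (sigma_gens entries)) R
        setT (fun w => T w i j) := @measurable_sigma_gens _ _ _ _ entries (i, j).
    exact: (measurableT_comp h measurable_fst).
  case: (i == j); last exact: measurable_cst.
  exact: (measurableT_comp (@measurable_sigma_gens _ _ _ _ V i) measurable_snd).
have F0 p : 0 <= F p by rewrite lee_fin phi0 //; exact: Hmat_sym.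
rewrite [leLHS](@integral_decouple _ Omega R P _ _ mG1 mG2 indep F mF F0).
have -> : K%:E = \int[P]_w (cst K%:E w).
  transitivity (K%:E * P setT); first by rewrite probability_setT mule1.
  by apply/esym; exact: (integral_cst P measurableT K%:E).
have mFF : measurable_fun setT (fun w1 : Omega => \int[P]_w2 F (w1, w2)).
  pose X2 : {mfun Omega >-> g_sigma_algebraType (sigma_gens V)} :=
    HB.pack (id : Omega -> g_sigma_algebraType (sigma_gens V))
      (isMeasurableFun.Build _ _ _ _ _ (measurable_coarse_id mG2)).
  have := @measurable_fun_fubini_tonelli_F _ _ _ _ R (distribution P X2) F mF F0.
  move=> /(measurable_coarse mG1); apply: eq_measurable_fun => w _.
  rewrite /fubini_F ge0_integral_pushforward //.
  exact: (measurableT_comp mF (@pair1_measurable _ _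
    (g_sigma_algebraType (sigma_gens entries))
    (g_sigma_algebraType (sigma_gens V)) w)).
apply: ge0_le_integral => //.
- by move=> w _; exact: integral_ge0.
- by move=> w _; exact: (@phiK (T w) (sT w)).
Qed.

Lemma expect_lor x (E r : R) : (0 < r)%R ->
  \int[P]_w (lor (ham w) E r x)%:E <= (6 * pi * c * r)%:E.
Proof.
move=> r0; apply: (integral_ham_le (phi := fun H => lor H E r x)).
- by move=> d' T' H sH mH; exact: measurable_lor.
- by move=> H sH; exact: lor_ge0.
- by move=> t st; exact: wegner.
Qed.

(** By [two_eig_strip] the second factor is at least 1 once two eigenvalues lie within [r] of [E];
    the sum over [x] then detects such a pair. *)
Definition pair_lor (H : 'M[R]_n) E r x : R :=
  (lor H E r x * \sum_(y | y != x) lor (strip H x) E r y)%R.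

Lemma pair_lor_ge0 H E r x : H^T = H -> (0 < r)%R -> (0 <= pair_lor H E r x)%R.
Proof.
move=> sH r0; rewrite mulr_ge0 ?lor_ge0 // sumr_ge0 // => y _.
by rewrite lor_ge0 // strip_sym.
Qed.

Lemma measurable_pair_lor d' (T' : measurableType d') (H : T' -> 'M[R]_n) E r x :
  (0 < r)%R -> (forall p, (H p)^T = H p) ->
  (forall i j, measurable_fun setT (fun p => H p i j)) ->
  measurable_fun setT (fun p => pair_lor (H p) E r x).
Proof.
move=> r0 sH mH; apply: measurable_funM; first exact: measurable_lor.
apply: (@eq_measurable_fun _ _ _ _ _
  (fun p => \sum_y if y != x then lor (strip (H p) x) E r y else 0)%R).
  by move=> p _; rewrite -big_mkcond.
apply: measurable_sum => y; case: (y != x); last exact: measurable_cst.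
apply: measurable_lor => //; first by move=> p; exact: strip_sym.
exact: measurable_strip.
Qed.

Lemma expect_pair_lor x (E r : R) : (0 < r)%R ->
  \int[P]_w (pair_lor (ham w) E r x)%:E <= (n%:R * (6 * pi * c * r) ^+ 2)%:E.
Proof.
move=> r0; apply: (integral_ham_le (phi := fun H => pair_lor H E r x)).
- by move=> d' T' H sH mH; exact: measurable_pair_lor.
- by move=> H sH; exact: pair_lor_ge0.
- by move=> t st; exact: minami.
Qed.

End RandomHopping.

(** * Smoothing of separated eigenvalues *)

Section Green.
Variables (R : realType) (n : nat).
Implicit Types (H Psi : 'M[R]_n) (lam : 'I_n -> R).

Lemma eigbasis_mulVmx H Psi lam : is_eigbasis H Psi lam -> Psi *m Psi^T = 1%:M.
Proof. by move=> [/mulmx1C]. Qed.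

Lemma eigbasis_row_sqr H Psi lam x : is_eigbasis H Psi lam ->
  \sum_k Psi x k ^+ 2 = 1.
Proof.
move=> /eigbasis_mulVmx /matrixP/(_ x x); rewrite !mxE eqxx mulr1n => <-.
by apply: eq_bigr => k _; rewrite mxE.
Qed.

Lemma eigbasis_col_sqr H Psi lam k : is_eigbasis H Psi lam ->
  \sum_x Psi x k ^+ 2 = 1.
Proof.
move=> [/matrixP/(_ k k) + _]; rewrite !mxE eqxx mulr1n => <-.
by apply: eq_bigr => x _; rewrite mxE.
Qed.

Lemma Im_sum (I : finType) (F : I -> complex.complex R) :
  complex.Im (\sum_i F i) = \sum_i complex.Im (F i).
Proof.
apply: (big_morph _ (id1 := 0) (op1 := +%R)) => //.
by move=> [a b] [c d].
Qed.

(** In the eigenbasis [H - z] is diagonal with nonzero entries, so its inverse is explicit; as [Psi]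
    is real, the imaginary part only acts on [1 / (lam k - z)]. *)
Lemma Im_green H Psi lam (E eta : R) x y : is_eigbasis H Psi lam -> 0 < eta ->
  complex.Im (green H x y (complex.Complex E eta))
  = \sum_k Psi x k * Psi y k * lorentz eta (lam k) E.
Proof.
move=> eb eta0; have [PP HP] := eb; have PP' := eigbasis_mulVmx eb.
pose toC := @real_complex R.
pose Pc := map_mx toC Psi.
pose z : complex.complex R := complex.Complex E eta.
pose D : 'M[complex.complex R]_n := diag_mx (\row_k (toC (lam k) - z)).
pose D' : 'M[complex.complex R]_n := diag_mx (\row_k (toC (lam k) - z)^-1).
have nz k : toC (lam k) - z != 0.
  by rewrite eq_complex /= negb_and sub0r oppr_eq0 (gt_eqF eta0) orbT.
have DD : D *m D' = 1%:M.
  apply/matrixP => i j; rewrite mul_diag_mx !mxE.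
  by case: eqVneq => [->|_]; rewrite ?mulr0n ?mulr0 // mulr1n divff.
have PcPc : Pc *m Pc^T = 1%:M by rewrite /Pc matrix.map_trmx -map_mxM PP' map_mx1.
have PcPc' : Pc^T *m Pc = 1%:M by rewrite /Pc matrix.map_trmx -map_mxM PP map_mx1.
pose A : 'M[complex.complex R]_n := map_mx toC H - z%:M.
have AE : A *m Pc = Pc *m D.
  rewrite /A mulmxBl -map_mxM HP map_mxM mul_scalar_mx.
  apply/matrixP => i j; rewrite mul_mx_diag !mxE (bigD1 j) //= big1 => [|k kj].
    by rewrite !mxE eqxx mulr1n addr0; ring.
  by rewrite !mxE (negPf kj) mulr0n rmorph0 mulr0.
have AB : A *m (Pc *m D' *m Pc^T) = 1%:M.
  by rewrite !mulmxA AE -(mulmxA Pc) DD mulmx1.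
have [uA _] := mulmx1_unit AB.
have -> : green H x y (complex.Complex E eta) = (Pc *m D' *m Pc^T) y x.
  rewrite /green -/z; congr (_ _ y x).
  by rewrite -[LHS]mulmx1 -[X in _ *m X = _]AB mulKmx.
rewrite !mxE Im_sum; apply: eq_bigr => k _.
rewrite mul_mx_diag !mxE /toC /lorentz /=.
by rewrite !(mul0r, mulr0, subr0, addr0, add0r, sub0r, opprK, oppr0, sqrrN)
  -(sqrrN (E - _)) opprB; ring.
Qed.

End Green.

Section PoissonSmoothing.
Variables (R : realType) (n : nat) (c lam t : 'I_n -> R) (eta a b : R).
Hypotheses (eta0 : 0 < eta) (ab : a < b).
Local Notation W k := (a <= lam k <= b).
Local Notation mu := (@lebesgue_measure R).
Hypothesis sep : forall k k', k != k' -> W k -> W k' ->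
  8 * eta < `|lam k - lam k'|.
Hypothesis inner : forall k, W k -> a + 4 * eta <= lam k <= b - 4 * eta.
Hypothesis outer : forall k, ~~ (W k) ->
  0 < t k /\ (lam k <= a - t k \/ b + t k <= lam k).

Let f E := \sum_k c k * lorentz eta (lam k) E.
Let J k : set R := `[lam k - 4 * eta, lam k + 4 * eta]%classic.

(* At most one interval [J k] contains [E], and there the [k]-th term of [f]
   is at most [f] plus all the other terms. *)
Let pointwise E :
  \sum_(k | W k) 2 * `|c k| * (lorentz eta (lam k) E * \1_(J k) E)
  <= `|f E| + \sum_k `|c k| * lorentz eta (lam k) E.
Proof.
have L0 k : 0 <= lorentz eta (lam k) E by exact: lorentz_ge0.
have [[k [Wk kE]]|noJ] := pselect (exists k, W k /\ J k E); last first.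
  rewrite big1 => [|k Wk].
    by rewrite addr_ge0 // sumr_ge0 // => k _; rewrite mulr_ge0.
  rewrite indicE memNset ?mulr0 ?mulr0 // => kE; apply: noJ.
  by exists k.
have J1 k' : k' != k -> W k' -> \1_(J k') E = 0 :> R.
  move=> kk' Wk'; rewrite indicE memNset // => k'E.
  move: kE k'E (sep kk' Wk' Wk); rewrite /J /= !in_itv /= ltr_normr.
  by move=> /andP[h1 h2] /andP[h3 h4] /orP[]; lra.
rewrite (bigD1 k) //= big1 => [|k' /andP[Wk' kk']]; last first.
  by rewrite J1 // !mulr0.
rewrite addr0 indicE mem_set // mulr1 (bigD1 k) //=.
have : `|c k| * lorentz eta (lam k) E
    <= `|f E| + \sum_(i | i != k) `|c i| * lorentz eta (lam i) E.
  have -> : `|c k| * lorentz eta (lam k) E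
      = `|f E - \sum_(i | i != k) c i * lorentz eta (lam i) E|.
    by rewrite /f (bigD1 k) //= addrK normrM (ger0_norm (L0 k)).
  apply: le_trans (ler_normB _ _) _; rewrite lerD2l.
  apply: le_trans (ler_norm_sum _ _ _) _; apply: ler_sum => i _.
  by rewrite normrM (ger0_norm (L0 i)).
by rewrite -mulrA; lra.
Qed.

Let mL k : measurable_fun setT (lorentz eta (lam k)).
Proof. exact: measurable_lorentz. Qed.

Local Open Scope ereal_scope.

(** Integrate [pointwise] over [[a, b]]. On the left each window of radius [4 eta] keeps mass at
    least [pi - 1/2], doubled to [2 pi - 1]. On the right an eigenvalue inside costs at most [pi],
    and one outside at most [eta / t k]. The difference leaves [pi - 1]. *)
Lemma poisson_smoothing :
  ((pi - 1) * \sum_(k | W k) `|c k|)%:E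
  <= \int[mu]_(E in `[a, b]) `|f E|%:E
     + (\sum_(k | ~~ (W k)) `|c k| * (eta / t k))%:E.
Proof.
pose D : set R := `[a, b]%classic.
have mD : measurable D by exact: measurable_itv.
have mJ k : measurable (J k) by exact: measurable_itv.
have mf : measurable_fun setT f.
  by apply: measurable_sum => k; apply: measurable_funM.
have mLD k : measurable_fun D (fun E => (lorentz eta (lam k) E)%:E).
  by apply/measurable_EFinP; exact: measurable_funTS.
have mLJ k : measurable_fun D (fun E => (lorentz eta (lam k) E * \1_(J k) E)%:E).
  by apply/measurable_EFinP; apply: measurable_funTS; apply: measurable_funM.
have LE k E : 0 <= (lorentz eta (lam k) E)%:E by rewrite lee_fin lorentz_ge0.
have c1 k : 0 <= `|c k|%:E by rewrite lee_fin.
have c2 k : 0 <= (2 * `|c k|)%:E by rewrite lee_fin mulr_ge0.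
have LJ k E : 0 <= (lorentz eta (lam k) E * \1_(J k) E)%:E.
  by rewrite lee_fin; apply: mulr_ge0 => //; exact: lorentz_ge0.
have int : \int[mu]_(E in D)
      (\sum_(k | W k) (2 * `|c k|)%:E * (lorentz eta (lam k) E * \1_(J k) E)%:E)
    <= \int[mu]_(E in D) (`|f E|%:E + \sum_k `|c k|%:E * (lorentz eta (lam k) E)%:E).
  apply: ge0_le_integral => //.
  - by move=> E _; apply: sume_ge0 => k _; exact: mule_ge0.
  - apply: (eq_measurable_fun (fun E => \sum_k if W k then
        (2 * `|c k|)%:E * (lorentz eta (lam k) E * \1_(J k) E)%:E else 0)).
      by move=> E _; rewrite -big_mkcond.
    apply: emeasurable_sum => k; case: (W k); last exact: measurable_cst.
    by apply: measurable_funeM; exact: mLJ.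
  - apply: emeasurable_funD.
      by apply/measurable_EFinP; apply: measurable_funTS; exact: measurableT_comp.
    by apply: emeasurable_sum => k; apply: measurable_funeM; exact: mLD.
  - move=> E _; have := pointwise E.
    rewrite -lee_fin EFinD -!sumEFin; apply: le_trans.
    by rewrite le_eqVlt; apply/orP; left; apply/eqP; apply: eq_bigr => k _; rewrite -EFinM.
have lower : ((2 * pi - 1) * \sum_(k | W k) `|c k|)%:E <= \int[mu]_(E in D)
      (\sum_(k | W k) (2 * `|c k|)%:E * (lorentz eta (lam k) E * \1_(J k) E)%:E).
  under eq_integral => E _ do rewrite big_mkcond /=.
  rewrite ge0_integral_sum //; last 2 first.
  - move=> k; case: (W k); last exact: measurable_cst.
    by apply: measurable_funeM; exact: mLJ.
  - by move=> k E _; case: ifP => // _; exact: mule_ge0.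
  rewrite big_distrr /= big_mkcond /= -sumEFin; apply: lee_sum => k _.
  case: (boolP (W k)) => [Wk|_]; last by rewrite integral0.
  rewrite ge0_integralZl //; last exact: mLJ.
  have -> : ((2 * pi - 1) * `|c k|)%:E = (2 * `|c k|)%:E * (pi - 2 / 4)%:E.
    by rewrite -EFinM; congr (_%:E); field.
  apply: lee_wpmul2l; first by rewrite lee_fin mulr_ge0.
  apply: le_trans (integral_lorentz_centered (lam k) eta0 _) _ => //.
  rewrite [leLHS]integral_mkcond [leRHS]integral_mkcond; apply: ge0_le_integral => //.
  - by move=> E _; rewrite patchE; case: ifP.
  - apply/(measurable_restrictT _ _).1 => //.
    by apply/measurable_EFinP; apply: measurable_funTS; exact: mL.
  - by apply/(measurable_restrictT _ _).1 => //; exact: mLJ.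
  - move=> E _; rewrite !patchE indicE; case: ifPn => [EJ|EJ]; last first.
      by case: ifP => // _; rewrite mulr0.
    rewrite mulr1 ifT //; move: EJ; rewrite !inE /J /D /= !in_itv /=.
    by have /andP[h1 h2] := inner Wk => /andP[h3 h4]; apply/andP; split; lra.
have upper : \int[mu]_(E in D) (`|f E|%:E + \sum_k `|c k|%:E * (lorentz eta (lam k) E)%:E)
    <= \int[mu]_(E in D) `|f E|%:E +
       (pi * (\sum_(k | W k) `|c k|) + \sum_(k | ~~ (W k)) `|c k| * (eta / t k))%:E.
  rewrite ge0_integralD //; last 3 first.
  - by apply/measurable_EFinP; apply: measurable_funTS; exact: measurableT_comp.
  - by move=> E _; apply: sume_ge0 => k _; exact: mule_ge0.
  - by apply: emeasurable_sum => k; apply: measurable_funeM; exact: mLD.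
  apply: leeD => //; rewrite ge0_integral_sum //; last 2 first.
  - by move=> k; apply: measurable_funeM; exact: mLD.
  - by move=> k E _; exact: mule_ge0.
  rewrite (bigID (fun k => W k)) /= EFinD; apply: leeD.
    rewrite big_distrr /= -sumEFin; apply: lee_sum => k _.
    rewrite ge0_integralZl //; last exact: mLD.
    rewrite mulrC EFinM; apply: lee_wpmul2l => //.
    exact: integral_lorentz_itv_le_pi.
  rewrite -sumEFin; apply: lee_sum => k Wk; have [tk far] := outer Wk.
  rewrite ge0_integralZl //; last exact: mLD.
  rewrite EFinM; apply: lee_wpmul2l => //.
  exact: integral_lorentz_far.
have := le_trans lower (le_trans int upper).
set S := \int[mu]_(E in _) _; set A := (\sum_(k | W k) _)%R; set B := (\sum_(k | _) _)%R.
move=> h; rewrite -leeBlDr // -EFinB; move: h; rewrite -leeBlDr // -EFinB.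
by apply: le_trans; rewrite lee_fin; lra.
Qed.

End PoissonSmoothing.

(** * Deterministic inequality on the good event *)

Section GoodEvent.
Variables (R : realType) (n : nat).
Implicit Types (H Psi : 'M[R]_n) (lam : 'I_n -> R).

Lemma lor_trace_ge1 H Psi lam (E r : R) k :
  H^T = H -> 0 < r -> is_eigbasis H Psi lam -> `|lam k - E| <= r ->
  1 <= \sum_z lor H E r z.
Proof.
move=> sH r0 eb kr; rewrite -(eigbasis_col_sqr k eb); apply: ler_sum => z _.
apply: le_trans (@eig_weight_le_lor _ _ _ _ _ _ _ z sH r0 eb).
by rewrite (bigD1 k) //= lerDl sumr_ge0 // => k' _; rewrite sqr_ge0.
Qed.

Lemma pair_lor_trace_ge1 H Psi lam (E r : R) k k' :
  H^T = H -> 0 < r -> is_eigbasis H Psi lam ->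
  k != k' -> `|lam k - E| <= r -> `|lam k' - E| <= r ->
  1 <= \sum_z pair_lor H E r z.
Proof.
move=> sH r0 eb kk' kr kr'; apply: le_trans (lor_trace_ge1 sH r0 eb kr) _.
apply: ler_sum => z _; rewrite /pair_lor ler_peMr ?lor_ge0 //.
exact: (two_eig_strip z sH r0 eb kk').
Qed.

(** The counterpart of the eigenvector weight [(N psi(x)^2 + 1) / 2], the constant 1 being replaced
    by a trace because eigenvectors are normalised. *)
Definition mixed_lor (x : 'I_n) H (E r : R) : R :=
  (n%:R * lor H E r x + \sum_z lor H E r z) / 2.

Lemma mixed_lor_ge0 x H (E r : R) : H^T = H -> 0 < r -> 0 <= mixed_lor x H E r.
Proof.
move=> sH r0; apply: divr_ge0 => //; apply: addr_ge0.
  by apply: mulr_ge0 => //; exact: lor_ge0.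
by apply: sumr_ge0 => z _; exact: lor_ge0.
Qed.

Lemma mixed_weight_le x H Psi lam (E r : R) :
  H^T = H -> 0 < r -> is_eigbasis H Psi lam ->
  \sum_(k | `|lam k - E| <= r) (n%:R * Psi x k ^+ 2 + 1) / 2 <= mixed_lor x H E r.
Proof.
move=> sH r0 eb; rewrite -big_distrl /= /mixed_lor ler_wpM2r // big_split /=.
apply: lerD.
  by rewrite -big_distrr /= ler_wpM2l // eig_weight_le_lor.
apply: (@le_trans _ _ (\sum_(k | `|lam k - E| <= r) \sum_z Psi z k ^+ 2)).
  by apply: ler_sum => k _; rewrite (eigbasis_col_sqr k eb).
by rewrite exchange_big /=; apply: ler_sum => z _; exact: eig_weight_le_lor.
Qed.

Lemma sum_mixed_weight x H Psi lam : is_eigbasis H Psi lam ->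
  \sum_k (n%:R * Psi x k ^+ 2 + 1) / 2 = n%:R :> R.
Proof.
move=> eb; rewrite -big_distrl /= big_split /= -big_distrr /=.
by rewrite (eigbasis_row_sqr x eb) sumr_const card_ord; field.
Qed.

(** Apply [|p q| <= (p^2 + q^2) / 2] termwise, extend the sum to all [y], and use that [psi_k] is
    normalised. *)
Lemma sum_abs_le_mixed (Y : {set 'I_n}) x H Psi lam k : is_eigbasis H Psi lam ->
  \sum_(y in Y) `|Psi x k * Psi y k| <= (n%:R * Psi x k ^+ 2 + 1) / 2.
Proof.
move=> eb; apply: (@le_trans _ _ (\sum_y (Psi x k ^+ 2 + Psi y k ^+ 2) / 2)).
  rewrite big_mkcond /=; apply: ler_sum => y _.
  have := sqr_ge0 (Psi x k - Psi y k); have := sqr_ge0 (Psi x k + Psi y k) => h1 h2.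
  by case: ifP => _; [rewrite ler_norml; apply/andP; split|]; nra.
rewrite -big_distrl /= ler_wpM2r // big_split /= (eigbasis_col_sqr k eb).
by rewrite sumr_const card_ord mulr_natl.
Qed.

Lemma dyadic_cover (s t : R) M : s <= t -> t < 2 ^+ M * s ->
  exists2 j : 'I_M, 2 ^+ j * s <= t & t <= 2 ^+ j.+1 * s.
Proof.
move=> st; elim: M => [|M IH].
  by rewrite expr0 mul1r => /lt_le_trans/(_ st); rewrite ltxx.
case: (ltP t (2 ^+ M * s)) => [/IH[j j1 j2] _|tM tM1].
  by exists (widen_ord (leqnSn M) j).
by exists ord_max => //; exact: ltW.
Qed.

Variables (x : 'I_n) (Y : {set 'I_n}) (a b eta s tau D : R) (m M : nat).

(** A value below 1 excludes every kind of failure at once, and its expectation bounds the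
    probability of failure. The summands detect, in order: an eigenvalue within [s] of [a]; one
    within [s] of [b]; two close eigenvalues, on a grid of step [8 eta]; leakage above [tau / 2]
    from the dyadic scales around the edges. *)
Definition bad_functional H : R :=
  \sum_z lor H a s z + \sum_z lor H b s z
  + \sum_(i < m) \sum_z pair_lor H (a + i%:R * (8 * eta)) (16 * eta) z
  + \sum_(j < M) 2 / tau * (eta / (2 ^+ j * s)) *
      (mixed_lor x H a (2 ^+ j.+1 * s) + mixed_lor x H b (2 ^+ j.+1 * s)).

Hypotheses (eta0 : 0 < eta) (ab : a < b) (s_ge : 4 * eta <= s) (tau0 : 0 < tau)
  (m_ge : b <= a + m%:R * (8 * eta)) (D0 : 0 < D)
  (far_small : n%:R * eta / D <= tau / 2) (DM : D <= 2 ^+ M * s).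

Let s0 : 0 < s. Proof. by apply: lt_le_trans s_ge; rewrite mulr_gt0. Qed.
Let rj0 j : 0 < 2 ^+ j * s. Proof. by rewrite mulr_gt0 // exprn_gt0. Qed.

Lemma bad_functional_terms_ge0 H : H^T = H ->
  [/\ 0 <= \sum_z lor H a s z, 0 <= \sum_z lor H b s z,
      0 <= \sum_(i < m) \sum_z pair_lor H (a + i%:R * (8 * eta)) (16 * eta) z
    & 0 <= \sum_(j < M) 2 / tau * (eta / (2 ^+ j * s)) *
      (mixed_lor x H a (2 ^+ j.+1 * s) + mixed_lor x H b (2 ^+ j.+1 * s))].
Proof.
move=> sH; split.
- by apply: sumr_ge0 => z _; exact: lor_ge0.
- by apply: sumr_ge0 => z _; exact: lor_ge0.
- apply: sumr_ge0 => i _; apply: sumr_ge0 => z _; apply: pair_lor_ge0 => //.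
  by rewrite mulr_gt0.
- apply: sumr_ge0 => j _; rewrite mulr_ge0 ?addr_ge0 ?mixed_lor_ge0 //.
  by rewrite mulr_ge0 // ?divr_ge0 // ltW.
Qed.

Variables (H Psi : 'M[R]_n) (lam : 'I_n -> R).
Hypotheses (sH : H^T = H) (eb : is_eigbasis H Psi lam)
  (good : bad_functional H < 1).
Local Notation W k := (a <= lam k <= b).

Let terms := bad_functional_terms_ge0 sH.

Let edge_a k : s < `|lam k - a|.
Proof.
rewrite ltNge; apply/negP => /(lor_trace_ge1 sH s0 eb) h.
by case: terms => h1 h2 h3 h4; move: good; rewrite /bad_functional; lra.
Qed.

Let edge_b k : s < `|lam k - b|.
Proof.
rewrite ltNge; apply/negP => /(lor_trace_ge1 sH s0 eb) h.
by case: terms => h1 h2 h3 h4; move: good; rewrite /bad_functional; lra.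
Qed.

Let inner k : W k -> a + 4 * eta <= lam k <= b - 4 * eta.
Proof.
move=> /andP[ak kb]; have := edge_a k; have := edge_b k.
rewrite (ger0_norm (_ : 0 <= lam k - a)) ?subr_ge0 //.
rewrite (ler0_norm (_ : lam k - b <= 0)) ?subr_le0 // => h1 h2.
by have h3 := s_ge; apply/andP; split; lra.
Qed.

Let sep k k' : k != k' -> W k -> W k' -> 8 * eta < `|lam k - lam k'|.
Proof.
move=> kk' Wk Wk'; rewrite ltNge; apply/negP => close.
have e8 : 0 < 8 * eta by rewrite mulr_gt0.
have /andP[ak kb] := inner Wk.
(* The grid point just below [lam k] is within [8 eta] of it, hence within [16 eta] of [lam k']. Its
   index is below [m] because [lam k < b]. *)
pose u := (lam k - a) / (8 * eta).
have uE : u * (8 * eta) = lam k - a by rewrite divfK // gt_eqF.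
have u0 : 0 <= u by rewrite divr_ge0 ?(ltW e8) // subr_ge0; case/andP: Wk.
have /andP[iu ui] := truncn_itv u0.
have im : (Num.truncn u < m)%N.
  rewrite -(ltr_nat R); apply: le_lt_trans iu _.
  by have hm := m_ge; rewrite /u ltr_pdivrMr //; lra.
have i1 : (Num.truncn u)%:R * (8 * eta) <= lam k - a by rewrite -uE ler_pM2r.
have i2 : lam k - a <= (Num.truncn u)%:R * (8 * eta) + 8 * eta.
  by rewrite -uE -[X in _ + X]mul1r -mulrDl natr1 ler_pM2r // ltW.
pose e := a + (Num.truncn u)%:R * (8 * eta).
have r0 : 0 < 16 * eta by rewrite mulr_gt0.
have k1 : `|lam k - e| <= 16 * eta by rewrite ler_norml /e; lra.
have k2 : `|lam k' - e| <= 16 * eta.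
  by move: close; rewrite !ler_norml /e; lra.
have h := pair_lor_trace_ge1 sH r0 eb kk' k1 k2.
case: terms => h1 h2 _ h4.
have h3 : 1 <= \sum_(i < m) \sum_z pair_lor H (a + i%:R * (8 * eta)) (16 * eta) z.
  rewrite (bigD1 (Ordinal im)) //=; apply: (le_trans h); rewrite lerDl.
  apply: sumr_ge0 => i _; apply: sumr_ge0 => z _; exact: pair_lor_ge0.
by move: good; rewrite /bad_functional; lra.
Qed.

Let dist k := if lam k < a then a - lam k else lam k - b.

Let outer k : ~~ (W k) ->
  0 < dist k /\ (lam k <= a - dist k \/ b + dist k <= lam k).
Proof.
rewrite /dist negb_and -!ltNge; case: ifP => [ka _|/negbT].
  by rewrite subr_gt0; split => //; left; lra.
rewrite -leNgt => ak /= bk.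
by rewrite subr_gt0; split => //; right; lra.
Qed.

Let wt k : R := (n%:R * Psi x k ^+ 2 + 1) / 2.

Let wt_ge0 k : 0 <= wt k.
Proof. by rewrite divr_ge0 // addr_ge0 // mulr_ge0 // sqr_ge0. Qed.

(** From distance [D] on, [eta / D] suffices. Nearer, [edge_a] and [edge_b] give [dist k >= s], and
    the dyadic scale containing [dist k] supplies the bound through the nearer edge; the other
    scales only add nonnegative terms. *)
Let tail_term k : ~~ (W k) ->
  wt k * (eta / dist k) <= wt k * (eta / D) + \sum_(j < M) (eta / (2 ^+ j * s)) *
    ((if `|lam k - a| <= 2 ^+ j.+1 * s then wt k else 0)
     + (if `|lam k - b| <= 2 ^+ j.+1 * s then wt k else 0)).
Proof.
move=> Wk; have [d0 _] := outer Wk.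
have sum0 (A : pred 'I_M) : 0 <= \sum_(j < M | A j) (eta / (2 ^+ j * s)) *
    ((if `|lam k - a| <= 2 ^+ j.+1 * s then wt k else 0)
     + (if `|lam k - b| <= 2 ^+ j.+1 * s then wt k else 0)).
  apply: sumr_ge0 => j _; rewrite mulr_ge0 //.
    by rewrite divr_ge0 // ltW.
  by rewrite addr_ge0 //; case: ifP.
case: (leP D (dist k)) => [Dd|dD].
  apply: (@le_trans _ _ (wt k * (eta / D))); last first.
    by rewrite lerDl; exact: (sum0 xpredT).
  by rewrite ler_wpM2l // ler_wpM2l ?(ltW eta0) // lef_pV2.
have sd : s <= dist k.
  have := edge_a k; have := edge_b k; move: Wk; rewrite /dist.
  case: ifP => [ka _|/negbT]; rewrite -?leNgt.
    by rewrite (ltr0_norm (_ : lam k - a < 0)) ?subr_lt0 //; lra.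
  move=> ak; rewrite ak /= -ltNge => bk.
  by rewrite (gtr0_norm (_ : 0 < lam k - b)) ?subr_gt0 //; lra.
have [j j1 j2] := dyadic_cover sd (lt_le_trans dD DM).
have h1 : wt k * (eta / dist k) <= (eta / (2 ^+ j * s)) * wt k.
  rewrite [leRHS]mulrC ler_wpM2l // ler_wpM2l ?(ltW eta0) // lef_pV2 ?posrE //.
have h2 : wt k <= (if `|lam k - a| <= 2 ^+ j.+1 * s then wt k else 0)
     + (if `|lam k - b| <= 2 ^+ j.+1 * s then wt k else 0).
  move: j2 Wk; rewrite /dist; case: ifP => [ka|/negbT]; rewrite -?leNgt.
    move=> j2 _; rewrite (ltr0_norm (_ : lam k - a < 0)) ?subr_lt0 // opprB j2.
    by rewrite lerDl; case: ifP.
  move=> ak j2; rewrite ak /= -ltNge => bk.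
  rewrite (gtr0_norm (_ : 0 < lam k - b)) ?subr_gt0 // j2 lerDr.
  by case: ifP.
apply: (le_trans h1); rewrite (bigD1 j) //= addrCA -[leLHS]addr0 lerD //.
  by rewrite ler_wpM2l // divr_ge0 // ltW.
by rewrite addr_ge0 // ?sum0 // mulr_ge0 // divr_ge0 // ltW.
Qed.

(** The weights sum to [n], so the far part is [n eta / D <= tau / 2]. The near part is at most
    [tau / 2] because the last term of [bad_functional] is below 1. *)
Let tail : \sum_(k | ~~ (W k)) wt k * (eta / dist k) <= tau.
Proof.
apply: (@le_trans _ _ (\sum_k (wt k * (eta / D) + \sum_(j < M) (eta / (2 ^+ j * s)) *
    ((if `|lam k - a| <= 2 ^+ j.+1 * s then wt k else 0)
     + (if `|lam k - b| <= 2 ^+ j.+1 * s then wt k else 0))))).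
  rewrite big_mkcond /=; apply: ler_sum => k _; case: ifP => [Wk|_].
    exact: tail_term.
  rewrite addr_ge0 //; first by rewrite mulr_ge0 // divr_ge0 // ltW.
  apply: sumr_ge0 => j _; rewrite mulr_ge0 //.
    by rewrite divr_ge0 // ltW.
  by rewrite addr_ge0 //; case: ifP.
rewrite big_split /= -big_distrl /= (sum_mixed_weight x eb) mulrA exchange_big /=.
have near : \sum_(j < M) \sum_k (eta / (2 ^+ j * s)) *
    ((if `|lam k - a| <= 2 ^+ j.+1 * s then wt k else 0)
     + (if `|lam k - b| <= 2 ^+ j.+1 * s then wt k else 0))
  <= \sum_(j < M) (eta / (2 ^+ j * s)) *
      (mixed_lor x H a (2 ^+ j.+1 * s) + mixed_lor x H b (2 ^+ j.+1 * s)).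
  apply: ler_sum => j _; rewrite -big_distrr /= ler_wpM2l //.
    by rewrite divr_ge0 // ltW.
  by rewrite big_split /= -!big_mkcond /=; apply: lerD; exact: mixed_weight_le.
have hf := far_small.
have : \sum_(j < M) (eta / (2 ^+ j * s)) *
      (mixed_lor x H a (2 ^+ j.+1 * s) + mixed_lor x H b (2 ^+ j.+1 * s)) <= tau / 2.
  set S := \sum_(j < M) _.
  have -> : S = tau / 2 * (2 / tau * S) by field; rewrite gt_eqF.
  rewrite -[leRHS]mulr1 ler_wpM2l ?divr_ge0 ?(ltW tau0) //.
  have -> : 2 / tau * S = \sum_(j < M) 2 / tau * (eta / (2 ^+ j * s)) *
      (mixed_lor x H a (2 ^+ j.+1 * s) + mixed_lor x H b (2 ^+ j.+1 * s)).
    by rewrite big_distrr /=; apply: eq_bigr => j _; rewrite mulrA.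
  by case: terms => h1 h2 h3 h4; move: good; rewrite /bad_functional; lra.
by lra.
Qed.

Local Open Scope ereal_scope.

(** Summing [poisson_smoothing] over [Y] gives [S >= (pi - 1) Q - tau]. After multiplication by
    [2 / pi] and addition of [tau], the surplus over [Q] is [(pi - 2) / pi] times [Q + tau],
    nonnegative as [pi >= 2]. *)
Lemma Qsum_le : (\sum_(y in Y) Qsum Psi lam a b x y)%:E <=
  (2 / pi)%:E * (\sum_(y in Y) \int[lebesgue_measure]_(E in `[a, b])
     (`|complex.Im (green H x y (complex.Complex E eta))|)%:E) + tau%:E.
Proof.
set S := (\sum_(y in Y) _)%E.
set Q := (\sum_(y in Y) _)%R.
have key : ((pi - 1) * Q - tau)%:E <= S.
  rewrite EFinB leeBlDr //.
  apply: (@le_trans _ _ (S + (\sum_(y in Y) \sum_(k | ~~ (W k))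
      `|Psi x k * Psi y k| * (eta / dist k))%:E)); last first.
    apply: leeD => //; rewrite lee_fin.
    rewrite exchange_big /=; apply: le_trans tail; apply: ler_sum => k Wk.
    have [d0 _] := outer Wk.
    rewrite -big_distrl /= ler_wpM2r ?divr_ge0 ?(ltW eta0) ?(ltW d0) //.
    exact: sum_abs_le_mixed eb.
  rewrite /Q big_distrr /= -!sumEFin -big_split /=; apply: lee_sum => y _.
  have h := @poisson_smoothing R n (fun k => Psi x k * Psi y k)%R lam dist eta a b
    eta0 ab sep inner outer.
  apply: le_trans h _; apply: leeD => //.
  rewrite le_eqVlt; apply/orP; left; apply/eqP; apply: eq_integral => E _.
  by rewrite (Im_green _ _ _ eb).
have pi0 := pi_gt0 R.
have := lee_wpmul2l (_ : 0 <= (2 / pi)%:E) key.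
rewrite lee_fin divr_ge0 ?(ltW pi0) // => /(_ isT) h.
apply: (@le_trans _ _ ((2 / pi)%:E * ((pi - 1) * Q - tau)%:E + tau%:E)).
  rewrite -EFinM -EFinD lee_fin.
  have Q0 : (0 <= Q)%R by apply: sumr_ge0 => y _; apply: sumr_ge0.
  have e (p : R) : (p != 0 -> 2 / p * ((p - 1) * Q - tau) + tau
      = Q + (p - 2) / p * Q + (p - 2) / p * tau)%R by move=> ?; field.
  have p2 : (0 <= (pi - 2) / pi :> R)%R by rewrite divr_ge0 ?(ltW pi0) // subr_ge0 pi_ge2.
  by rewrite e ?gt_eqF // -addrA lerDl addr_ge0 // mulr_ge0 // ltW.
by apply: leeD.
Qed.

End GoodEvent.

(** * Probability of the exceptional set *)

Section ExpectationBounds.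
Local Open Scope ereal_scope.
Context d (Omega : measurableType d) (R : realType) (P : probability Omega R).

(** Measurability and sign are bundled with the bound so that bounds add and scale without side
    conditions on integrals. *)
Definition expect_le (f : Omega -> R) (K : R) :=
  [/\ measurable_fun setT f, (forall w, 0 <= f w)%R
    & \int[P]_w (f w)%:E <= K%:E].

Lemma expect_leD f g K L : expect_le f K -> expect_le g L ->
  expect_le (fun w => f w + g w)%R (K + L)%R.
Proof.
move=> [mf f0 fK] [mg g0 gL]; split.
- exact: measurable_funD.
- by move=> w; rewrite addr_ge0.
- under eq_integral => w _ do rewrite EFinD.
  have mf' : measurable_fun setT (fun w => (f w)%:E) by exact/measurable_EFinP.
  have mg' : measurable_fun setT (fun w => (g w)%:E) by exact/measurable_EFinP.
  have f0' w : setT w -> 0 <= (f w)%:E by rewrite lee_fin.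
  have g0' w : setT w -> 0 <= (g w)%:E by rewrite lee_fin.
  by rewrite ge0_integralD // EFinD; exact: leeD.
Qed.

Lemma expect_leZ (a : R) f K : (0 <= a)%R -> expect_le f K ->
  expect_le (fun w => a * f w)%R (a * K)%R.
Proof.
move=> a0 [mf f0 fK]; split.
- by apply: measurable_funM => //; exact: measurable_cst.
- by move=> w; rewrite mulr_ge0.
- under eq_integral => w _ do rewrite EFinM.
  have mf' : measurable_fun setT (fun w => (f w)%:E) by exact/measurable_EFinP.
  have f0' w : setT w -> 0 <= (f w)%:E by rewrite lee_fin.
  have a0' : 0 <= a%:E by rewrite lee_fin.
  by rewrite ge0_integralZl // EFinM; exact: lee_wpmul2l.
Qed.

Lemma expect_le_sum (I : finType) (f : I -> Omega -> R) (K : I -> R) :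
  (forall i, expect_le (f i) (K i)) ->
  expect_le (fun w => \sum_i f i w)%R (\sum_i K i)%R.
Proof.
move=> fK; split.
- by apply: measurable_sum => i; case: (fK i).
- by move=> w; apply: sumr_ge0 => i _; case: (fK i).
- under eq_integral => w _ do rewrite -sumEFin.
  rewrite ge0_integral_sum //; last 2 first.
  + by move=> i; apply/measurable_EFinP; case: (fK i).
  + by move=> i w _; rewrite lee_fin; case: (fK i).
  by rewrite -sumEFin; apply: lee_sum => i _; case: (fK i).
Qed.

Lemma prob_le_expect (A : set Omega) f K : measurable A ->
  expect_le f K -> (forall w, A w -> 1 <= f w)%R -> P A <= K%:E.
Proof.
move=> mA [mf f0 fK] Af; apply: le_trans fK.
rewrite -(setIT A) -integral_indic //; apply: ge0_le_integral => //.
- exact/measurable_EFinP.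
- exact/measurable_EFinP.
- move=> w _; rewrite lee_fin indicE; case: (boolP (w \in A)) => [|_].
    by rewrite inE => /Af.
  exact: f0.
Qed.

End ExpectationBounds.

Section ExceptionalSet.
Local Open Scope ereal_scope.
Context d (Omega : measurableType d) (R : realType) (P : probability Omega R).
Variables (n : nat) (T : Omega -> 'M[R]_n) (V : 'I_n -> Omega -> R) (c : R)
  (Psi : Omega -> 'M[R]_n) (lam : Omega -> 'I_n -> R).
Hypotheses (mT : forall i j, measurable_fun setT (fun w => T w i j))
  (sT : forall w, (T w)^T = T w)
  (mV : forall x, measurable_fun setT (V x)) (c0 : (0 <= c)%R).
Hypothesis indep : forall A B,
  sigma_gen (fun ij : 'I_n * 'I_n => fun w => T w ij.1 ij.2) A ->
  sigma_gen V B -> P (A `&` B) = P A * P B.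
Hypothesis dom : forall (x : 'I_n) (I : set R) (B : set Omega), measurable I ->
  sigma_gen (fun y : {y : 'I_n | y != x} => V (sval y)) B ->
  P (V x @^-1` I `&` B) <= c%:E * lebesgue_measure I * P B.
Hypotheses (mPsi : forall i j, measurable_fun setT (fun w => Psi w i j))
  (mlam : forall k, measurable_fun setT (fun w => lam w k)).
Local Notation ham w := (Hmat (T w) (V ^~ w)).
Hypothesis eb : forall w, is_eigbasis (ham w) (Psi w) (lam w).

Variables (x : 'I_n) (Y : {set 'I_n}) (a b eta tau : R).

Definition exceptional : set Omega :=
  [set w | (\sum_(y in Y) Qsum (Psi w) (lam w) a b x y)%:E >
    (2 / pi)%:E * (\sum_(y in Y) \int[lebesgue_measure]_(E in `[a, b])
      (`|complex.Im (green (ham w) x y (complex.Complex E eta))|)%:E) + tau%:E].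

Hypothesis eta0 : (0 < eta)%R.

(** By [Im_green] the integrand is jointly measurable in the sample point and [E]; Tonelli makes its
    integral measurable. *)
Lemma measurable_exceptional : measurable exceptional.
Proof.
rewrite -[exceptional]setTI; apply: measurable_lte => //; last first.
  apply/measurable_EFinP.
  apply: (eq_measurable_fun (fun w => \sum_y if y \in Y then
      \sum_k (if a <= lam w k <= b then `|Psi w x k * Psi w y k| else 0) else 0)%R).
    move=> w _; rewrite [RHS]big_mkcond /=; apply: eq_bigr => y _.
    by case: ifP => // _; rewrite /Qsum [RHS]big_mkcond.
  apply: measurable_sum => y; case: (y \in Y); last exact: measurable_cst.
  apply: measurable_sum => k; apply: measurable_fun_ifT.
  - apply: measurable_and; apply: measurable_fun_ler => //; exact: measurable_cst.
  - by apply: measurableT_comp => //; exact: measurable_funM.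
  - exact: measurable_cst.
apply: emeasurable_funD; last exact: measurable_cst.
apply: measurable_funeM.
apply: (eq_measurable_fun (fun w => \sum_y if y \in Y then
   \int[lebesgue_measure]_(E in `[a, b])
     `|\sum_k Psi w x k * Psi w y k * lorentz eta (lam w k) E|%:E else 0)).
  move=> w _; rewrite [RHS]big_mkcond /=; apply: eq_bigr => y _.
  case: ifP => // _; apply: eq_integral => E _.
  by rewrite (Im_green _ _ _ (eb w)).
apply: emeasurable_sum => y; case: (y \in Y); last exact: measurable_cst.
pose D : set R := `[a, b]%classic.
have mD : measurable D by exact: measurable_itv.
pose F (p : Omega * R) := (`|\sum_k Psi p.1 x k * Psi p.1 y k *
  lorentz eta (lam p.1 k) p.2| * \1_D p.2)%:E.
have mF : measurable_fun setT F.
  apply/measurable_EFinP; apply: measurable_funM; last first.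
    by apply: measurableT_comp => //; exact: measurable_snd.
  apply: measurableT_comp => //; apply: measurable_sum => k.
  apply: measurable_funM; first apply: measurable_funM.
  - exact: (measurableT_comp (mPsi x k) measurable_fst).
  - exact: (measurableT_comp (mPsi y k) measurable_fst).
  apply: measurable_lorentz_comp; first exact: measurable_cst.
    exact: (measurableT_comp (mlam k) measurable_fst).
  exact: measurable_snd.
have F0 p : 0 <= F p by rewrite lee_fin mulr_ge0.
apply: (eq_measurable_fun (fubini_F lebesgue_measure F)); last first.
  exact: measurable_fun_fubini_tonelli_F.
move=> w _; rewrite [RHS]integral_mkcond; apply: eq_integral => E _.
rewrite patchE /F /= indicE -/D; case: ifP => _; by rewrite ?mulr1 ?mulr0.
Qed.

Lemma ham_sym w : (ham w)^T = ham w.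
Proof. exact: Hmat_sym. Qed.

Lemma measurable_ham i j : measurable_fun setT (fun w => ham w i j).
Proof.
apply: (eq_measurable_fun (fun w => T w i j + V i w *+ (i == j))%R).
  by move=> w _; rewrite !mxE.
apply: measurable_funD => //.
by case: (i == j); [exact: mV|exact: measurable_cst].
Qed.

Lemma expect_le_lor E r z : (0 < r)%R ->
  expect_le P (fun w => lor (ham w) E r z) (6 * pi * c * r).
Proof.
move=> r0; split.
- by apply: measurable_lor => //; [exact: ham_sym|exact: measurable_ham].
- by move=> w; apply: lor_ge0 => //; exact: ham_sym.
- exact: expect_lor.
Qed.

Lemma expect_le_trace E r : (0 < r)%R ->
  expect_le P (fun w => \sum_z lor (ham w) E r z)%R (n%:R * (6 * pi * c * r)).
Proof.
move=> r0; have -> : (n%:R * (6 * pi * c * r) = \sum_(z < n) 6 * pi * c * r)%R.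
  by rewrite sumr_const card_ord [LHS]mulr_natl.
by apply: expect_le_sum => z; exact: expect_le_lor.
Qed.

Lemma expect_le_mixed E r : (0 < r)%R ->
  expect_le P (fun w => mixed_lor x (ham w) E r) (n%:R * (6 * pi * c * r)).
Proof.
move=> r0; have -> : (n%:R * (6 * pi * c * r) =
    2^-1 * (n%:R * (6 * pi * c * r) + n%:R * (6 * pi * c * r)))%R by field.
have -> : (fun w => mixed_lor x (ham w) E r) = (fun w => 2^-1 *
    (n%:R * lor (ham w) E r x + \sum_z lor (ham w) E r z))%R.
  by apply/funext => w; rewrite /mixed_lor mulrC.
apply: expect_leZ => //; apply: expect_leD; last exact: expect_le_trace.
by apply: expect_leZ => //; exact: expect_le_lor.
Qed.

Lemma expect_le_pairs E r : (0 < r)%R ->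
  expect_le P (fun w => \sum_z pair_lor (ham w) E r z)%R
    (n%:R * (n%:R * (6 * pi * c * r) ^+ 2)).
Proof.
move=> r0; have -> : (n%:R * (n%:R * (6 * pi * c * r) ^+ 2)
    = \sum_(z < n) n%:R * (6 * pi * c * r) ^+ 2)%R.
  by rewrite sumr_const card_ord [LHS]mulr_natl.
apply: expect_le_sum => z; split.
- by apply: measurable_pair_lor => //; [exact: ham_sym|exact: measurable_ham].
- by move=> w; apply: pair_lor_ge0 => //; exact: ham_sym.
- exact: expect_pair_lor.
Qed.

Variables (s D : R) (m M : nat).
Hypotheses (ab : (a < b)%R) (s_ge : (4 * eta <= s)%R) (tau0 : (0 < tau)%R)
  (m_ge : (b <= a + m%:R * (8 * eta))%R) (D0 : (0 < D)%R)
  (far_small : (n%:R * eta / D <= tau / 2)%R) (DM : (D <= 2 ^+ M * s)%R).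

Let s0 : (0 < s)%R. Proof. by apply: lt_le_trans s_ge; rewrite mulr_gt0. Qed.

Lemma prob_exceptional : P exceptional <=
  (6 * pi * c * (2 * n%:R * s + M%:R * (8 * n%:R * eta / tau))
   + m%:R * (n%:R * (n%:R * (6 * pi * c * (16 * eta)) ^+ 2)))%:E.
Proof.
pose f w := bad_functional x a b eta s tau m M (ham w).
have -> : (6 * pi * c * (2 * n%:R * s + M%:R * (8 * n%:R * eta / tau))
   + m%:R * (n%:R * (n%:R * (6 * pi * c * (16 * eta)) ^+ 2)) =
   n%:R * (6 * pi * c * s) + n%:R * (6 * pi * c * s)
   + \sum_(i < m) n%:R * (n%:R * (6 * pi * c * (16 * eta)) ^+ 2)
   + \sum_(j < M) 2 / tau * (eta / (2 ^+ j * s)) *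
      (n%:R * (6 * pi * c * (2 ^+ j.+1 * s)) + n%:R * (6 * pi * c * (2 ^+ j.+1 * s))))%R.
  rewrite [X in (_ = _ + X + _)%R]sumr_const card_ord -[X in (_ = _ + X + _)%R]mulr_natl.
  (* All dyadic scales contribute equally: the factor [eta / (2^j s)] cancels the width [2^(j+1) s]
     of the Wegner bound. *)
  rewrite [X in (_ = _ + X)%R](eq_bigr (fun=> 6 * pi * c * (8 * n%:R * eta / tau)))%R.
    by rewrite sumr_const card_ord -[X in (_ = _ + X)%R]mulr_natl; ring.
  move=> j _; rewrite exprS; field.
  by rewrite (gt_eqF s0) (gt_eqF tau0) expf_neq0.
apply: (@prob_le_expect _ _ _ _ _ f); first exact: measurable_exceptional.
  have e0 : (0 < 16 * eta)%R by rewrite mulr_gt0.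
  rewrite /f /bad_functional; apply: expect_leD; first apply: expect_leD.
  - by apply: expect_leD; exact: expect_le_trace.
  - by apply: expect_le_sum => i; exact: expect_le_pairs.
  apply: expect_le_sum => j; apply: expect_leZ.
    rewrite mulr_ge0 // divr_ge0 // ?ltW // mulr_gt0 // exprn_gt0 //.
  by apply: expect_leD; apply: expect_le_mixed; rewrite mulr_gt0 // exprn_gt0.
move=> w; rewrite /exceptional /= => h; rewrite leNgt; apply/negP => good.
have := @Qsum_le R n x Y a b eta s tau D m M eta0 ab s_ge tau0 m_ge D0 far_small
  DM (ham w) (Psi w) (lam w) (ham_sym w) (eb w) good.
by move=> /(lt_le_trans h); rewrite ltxx.
Qed.

End ExceptionalSet.

(** * Choice of the scales *)

Section Scales.
Variable R : realType.

(** Monotonicity reduces to [ln 2], and [ln (1 + t) <= t] at [t = -1/2] handles that case. *)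
Lemma ln_ge_half (N : nat) : (1 < N)%N -> 1 / 2 <= ln (N%:R : R).
Proof.
move=> N1; have N0 : (0 : R) < N%:R by rewrite ltr0n ltnW.
have h : -1 < - (1 / 2) :> R by lra.
apply: (@le_trans _ _ (ln (2 : R))); last first.
  by rewrite ler_ln ?posrE // ler_nat.
have := le_ln1Dx h; have -> : 1 + - (1 / 2) = 2^-1 :> R by lra.
by rewrite lnV ?posrE //; lra.
Qed.

Lemma dyadic_scales (N : nat) : (1 < N)%N ->
  exists2 M : nat, (N%:R : R) <= 2 ^+ M & (M%:R : R) <= 4 * ln (N%:R : R).
Proof.
move=> N1; have N0 : (0 < N)%N by exact: ltnW.
exists (trunc_log 2 N).+1.
  by rewrite -natrX ler_nat ltnW // trunc_log_ltn.
have h := ln_ge_half N1; have h2 := @ln_ge_half 2 isT.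
have : ln (2 ^+ trunc_log 2 N : R) <= ln N%:R.
  rewrite ler_ln ?posrE ?exprn_gt0 ?ltr0n // -natrX ler_nat.
  by have /andP[] := trunc_log_bounds (isT : (1 < 2)%N) N0.
rewrite lnXn // -[X in X <= _]mulr_natl => h3.
have : (trunc_log 2 N)%:R * (1 / 2) <= (trunc_log 2 N)%:R * ln (2 : R).
  by rewrite ler_wpM2l.
by rewrite -[(trunc_log 2 N).+1%:R]natr1; lra.
Qed.

(** The three last bounds are the costs of edges, leakage and pairs, each a multiple of [N^(w - l)].
    The [ln N] in [tau] pays for the [O(ln N)] dyadic scales. *)
Lemma scale_choice (N : nat) (w l : R) : (1 < N)%N -> 0 < w -> w < l ->
  let L := N%:R : R in
  let delta := L `^ (- (1 - w)) in let eta := L `^ (- (1 + l)) in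
  let tau := ln L / L `^ w in
  exists s D m M, [/\ 4 * eta <= s, 0 < tau, 2 * delta <= m%:R * (8 * eta),
    0 < D & L * eta / D <= tau / 2] /\
    [/\ D <= 2 ^+ M * s, L * s = 4 * L `^ (w - l),
     L * (M%:R * (eta / tau)) <= 4 * L `^ (w - l)
     & m%:R * (L * (L * eta ^+ 2)) <= 2 * L `^ (w - l)].
Proof.
move=> N1 w0 wl L delta eta tau.
have L1 : 1 < L by rewrite ltr1n.
have L0 : 0 < L by lra.
have Ln0 : L != 0 by rewrite gt_eqF.
have PD r t : L `^ (r + t) = L `^ r * L `^ t by rewrite powRD // Ln0 implybT.
have P1 : L `^ 1 = L by rewrite powRr1 // ltW.
pose u := L `^ w; have u0 : 0 < u by exact: powR_gt0.
have u1 : 1 <= u.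
  by rewrite -(powRr0 L); apply: ler_powR; [exact: ltW|exact: ltW].
have eta0 : 0 < eta by exact: powR_gt0.
have delta0 : 0 < delta by exact: powR_gt0.
have lnL : 1 / 2 <= ln L by exact: ln_ge_half.
have lnL0 : 0 < ln L by lra.
set p := L `^ (w - l).
have pE : p = u * L * eta.
  transitivity (L `^ w * L `^ 1 * eta); last by rewrite P1.
  by rewrite /p /eta -!PD; congr (_ `^ _); ring.
have dE : L ^+ 2 * delta * eta = p.
  transitivity (L `^ 1 * L `^ 1 * delta * eta); first by rewrite P1 expr2.
  by rewrite /p /delta /eta -!PD; congr (_ `^ _); ring.
have ed : eta <= delta.
  by apply: ler_powR; [exact: ltW|lra].
have [M LM Mln] := dyadic_scales N1.
(* [D] makes [L eta / D] equal to [tau / 2]; [m] steps of [8 eta] cover the length [2 delta]; [M]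
   doublings of [s] reach [D], since [D = s L / (2 ln L)] and [2 ln L >= 1]. *)
exists (4 * u * eta), (2 * L * u * eta / ln L), (Num.truncn (delta / (4 * eta))).+1, M.
have tau0 : 0 < tau by rewrite divr_gt0.
have de0 : 0 <= delta / (4 * eta).
  by rewrite divr_ge0 ?(ltW delta0) // ltW // mulr_gt0.
split; split => //.
- by rewrite ler_pM2r //; lra.
- have h : delta / (4 * eta) <= (Num.truncn (delta / (4 * eta))).+1%:R.
    by have /andP[_ /ltW] := truncn_itv de0.
  move: h; rewrite ler_pdivrMr ?mulr_gt0 //; lra.
- by rewrite !mulr_gt0 // invr_gt0.
- rewrite le_eqVlt; apply/orP; left; apply/eqP; rewrite /tau -/u; field.
  by rewrite !gt_eqF.
- have -> : 2 * L * u * eta / ln L = (L / (2 * ln L)) * (4 * u * eta).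
    by field; rewrite gt_eqF.
  rewrite ler_wpM2r ?mulr_ge0 ?(ltW u0) ?(ltW eta0) //.
  apply: le_trans LM; rewrite ler_pdivrMr ?mulr_gt0 //.
  by rewrite ler_peMr ?(ltW L0) //; lra.
- by rewrite pE; ring.
- rewrite pE /tau -/u.
  have -> : L * (M%:R * (eta / (ln L / u))) = (u * L * eta) * (M%:R / ln L).
    by field; rewrite !gt_eqF.
  rewrite [leRHS]mulrC ler_wpM2l ?mulr_ge0 ?(ltW u0) ?(ltW L0) ?(ltW eta0) //.
  by rewrite ler_pdivrMr.
- have h : (Num.truncn (delta / (4 * eta))).+1%:R <= 2 * (delta / eta) :> R.
    rewrite -natr1.
    have h1 : (Num.truncn (delta / (4 * eta)))%:R <= delta / (4 * eta).
      by have /andP[] := truncn_itv de0.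
    have h2 : delta / (4 * eta) = delta / eta / 4 by field; rewrite gt_eqF.
    have h3 : 1 <= delta / eta by rewrite ler_pdivlMr // mul1r.
    by rewrite h2 in h1 *; lra.
  have -> : 2 * p = 2 * (delta / eta) * (L * (L * eta ^+ 2)).
    by rewrite -dE; field; rewrite gt_eqF.
  rewrite ler_wpM2r //; apply: mulr_ge0; first exact: ltW.
  by apply: mulr_ge0; [exact: ltW|exact: sqr_ge0].
Qed.

End Scales.

(** * Assembly of the estimates *)

Theorem theorem6p1 (R : realType) (C_V : R) :
  exists C : R,
  forall (N : nat) (d : measure_display) (Omega : measurableType d)
    (P : probability Omega R)
    (T : Omega -> 'M[R]_N) (V : 'I_N -> Omega -> R)
    (Psi : Omega -> 'M[R]_N) (lam : Omega -> 'I_N -> R),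
  (* T is a real symmetric random matrix *)
  (forall i j, measurable_fun setT (fun om => T om i j)) ->
  (forall om, (T om)^T = T om) ->
  (* V is a random potential *)
  (forall x, measurable_fun setT (V x)) ->
  (* T is independent of V *)
  (forall A B, sigma_gen (fun ij : 'I_N * 'I_N => fun om => T om ij.1 ij.2) A ->
     sigma_gen V B -> P (A `&` B) = (P A * P B)%E) ->
  (* P(V(x) in I | {V(y)}_{y <> x}) <= C_V |I|, for all Borel I and all x
     (written as: for every event B of sigma({V(y)}_{y<>x}),
      P({V(x) in I} /\ B) <= C_V |I| P(B)) *)
  (forall (x : 'I_N) (I : set R) (B : set Omega), measurable I ->
     sigma_gen (fun y : {y : 'I_N | y != x} => V (sval y)) B ->
     (P (V x @^-1` I `&` B) <= C_V%:E * lebesgue_measure I * P B)%E) ->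
  (* {psi_lambda} : a (measurably chosen) orthonormal basis of real eigenvectors of H *)
  (forall i j, measurable_fun setT (fun om => Psi om i j)) ->
  (forall k, measurable_fun setT (fun om => lam om k)) ->
  (forall om, is_eigbasis (Hmat (T om) (fun x => V x om)) (Psi om) (lam om)) ->
  forall (w E0 l : R) (Y : {set 'I_N}) (x : 'I_N),
  0 < w -> w < l ->
  let delta := (N%:R : R) `^ (- (1 - w)) in
  let eta := (N%:R : R) `^ (- (1 + l)) in
  let W : set R := `[E0 - delta, E0 + delta]%classic in
  (P [set om | ((\sum_(y in Y) Qsum (Psi om) (lam om) (E0 - delta) (E0 + delta) x y)%:E
        > (2 / pi)%:E *
          (\sum_(y in Y)
             \int[lebesgue_measure]_(E in W)
               (`|complex.Im (green (Hmat (T om) (fun z => V z om)) x y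
                                   (complex.Complex E eta))|)%:E)
          + (ln (N%:R : R) / (N%:R : R) `^ w)%:E)%E]
    <= (C * (N%:R : R) `^ (w - l))%:E)%E.
Proof.
(* The absolute value makes [q] nonnegative whatever the sign of [C_V]. In the constant, 1 covers
   [N = 1], [40 = 8 + 32] the edges and the leakage, and [512 = 2 * 16^2] the pairs. *)
pose q : R := 6 * pi * `|C_V|.
have q0 : 0 <= q by rewrite !mulr_ge0 // pi_ge0.
exists (1 + 40 * q + 512 * q ^+ 2).
move=> N d Omega P T V Psi lam mT sT mV indep dom mPsi mlam eb w E0 l Y x w0 wl.
pose delta : R := N%:R `^ (- (1 - w)); pose eta : R := N%:R `^ (- (1 + l)).
cbv zeta; rewrite -/delta -/eta.
have N0 : (0 < N)%N by apply: leq_ltn_trans (ltn_ord x).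
have eta0 : 0 < eta by rewrite powR_gt0 // ltr0n.
have delta0 : 0 < delta by rewrite powR_gt0 // ltr0n.
have p0 : 0 <= (N%:R : R) `^ (w - l) by exact: powR_ge0.
set tau := ln (N%:R : R) / (N%:R : R) `^ w.
suff main : (P (exceptional T V Psi lam x Y (E0 - delta)%R (E0 + delta)%R eta tau)
    <= ((1 + 40 * q + 512 * q ^+ 2) * (N%:R : R) `^ (w - l))%:E)%E.
  exact: main.
have mex := measurable_exceptional mPsi mlam eb x Y (E0 - delta) (E0 + delta) tau eta0.
move: N0; rewrite leq_eqVlt => /predU1P[N1|N1].
  (* For [N = 1] the power of [N] is 1, and the trivial bound on a probability suffices. *)
  apply: (le_trans (probability_le1 P mex)).
  rewrite lee_fin -N1 powR1 mulr1 -addrA lerDl.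
  by apply: addr_ge0; apply: mulr_ge0; rewrite ?ler0n ?sqr_ge0.
have dom' (z : 'I_N) (I : set R) (B : set Omega) : measurable I ->
    sigma_gen (fun y : {y : 'I_N | y != z} => V (sval y)) B ->
    (P (V z @^-1` I `&` B) <= `|C_V|%:E * lebesgue_measure I * P B)%E.
  move=> mI mB; apply: (le_trans (dom z I B mI mB)).
  apply: lee_wpmul2r => //; apply: lee_wpmul2r => //.
  by rewrite lee_fin ler_norm.
have [s [D [m [M [[h1 h2 h3 h4 h5] [h6 h7 h8 h9]]]]]] :=
  @scale_choice R N w l N1 w0 wl.
have ab : E0 - delta < E0 + delta by lra.
have mge : E0 + delta <= E0 - delta + m%:R * (8 * eta).
  by rewrite -/delta -/eta in h3; lra.
apply: le_trans (prob_exceptional mT sT mV (normr_ge0 C_V) indep dom' mPsi mlam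
  eb x Y eta0 ab h1 h2 mge h4 h5 h6) _.
rewrite -/q lee_fin; move: h7 h8 h9; rewrite -/eta -/tau.
set p := _ `^ (w - l) in p0 *; set L : R := N%:R => h7 h8 h9.
have -> : 2 * L * s = 2 * (L * s) by ring.
have -> : M%:R * (8 * L * eta / tau) = 8 * (L * (M%:R * (eta / tau))) by ring.
have -> : m%:R * (L * (L * (q * (16 * eta)) ^+ 2))
  = 256 * q ^+ 2 * (m%:R * (L * (L * eta ^+ 2))) by ring.
have e1 : q * (2 * (L * s) + 8 * (L * (M%:R * (eta / tau)))) <= q * (8 * p + 32 * p).
  by rewrite ler_wpM2l //; lra.
have e2 : 256 * q ^+ 2 * (m%:R * (L * (L * eta ^+ 2))) <= 256 * q ^+ 2 * (2 * p).
  apply: ler_wpM2l h9; apply: mulr_ge0; [exact: ler0n|exact: sqr_ge0].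
apply: (le_trans (lerD e1 e2)).
have -> : (1 + 40 * q + 512 * q ^+ 2) * p
  = p + (q * (8 * p + 32 * p) + 256 * q ^+ 2 * (2 * p)) by ring.
by rewrite lerDr.
Qed.
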